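(* Let $G_m$ be a bounded Vilenkin group. a) Let $\{q_k:k\ge0\}$ be a non-decreasing sequence of non-negative numbers with $q_0>0$ satisfying $$\frac{q_{n-1}}{Q_n}=O\left(\frac1n\right)\quad\text{as }n\to\infty .$$ Then the maximal operator $T^*f:=\sup_{n\in\mathbb{N}_+}|T_nf|$ of the corresponding $T$ means is bounded from the Hardy space $H_{1/2}$ to the space $weak\text{-}L_{1/2}$. b) Let $0<p<1/2$. For any non-decreasing sequence $\{q_k:k\ge0\}$ of non-negative numbers with $q_0>0$ there exists a martingale $f\in H_p$ such that $$\sup_{n\in\mathbb{N}_+}\|T_nf\|_{weak\text{-}L_p}=\infty .$$
   Context: Let $m=(m_0,m_1,\ldots)$ be a fixed sequence of integers $m_k\ge 2$ with $\sup_k m_k<\infty$. $G_m=\prod_{k\ge0}Z_{m_k}$, $Z_{m_k}=\{0,\ldots,m_k-1\}$ the integers mod $m_k$, is the bounded Vilenkin group with product (of discrete) topology and normalized Haar measure $\mu$. $I_0(x)=G_m$, $I_n(x)=\{y\in G_m: y_0=x_0,\ldots,y_{n-1}=x_{n-1}\}$. $M_0=1$, $M_{k+1}=m_kM_k$; every $n\in\mathbb{N}$ is uniquely $n=\sum_j n_jM_j$ with $n_j\in Z_{m_j}$. $r_k(x)=\exp(2\pi i x_k/m_k)$ and $\psi_n=\prod_k r_k^{n_k}$ (Vilenkin system). $\mathbb{N}_+=\{1,2,\ldots\}$, $\mathbb{N}=\mathbb{N}_+\cup\{0\}$. For $f\in L_1(G_m)$: $\widehat f(n)=\int_{G_m}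 f\overline{\psi_n}\,d\mu$; $S_0f=0$, $S_nf=\sum_{k=0}^{n-1}\widehat f(k)\psi_k$. $\|g\|_p=(\int_{G_m}|g|^pd\mu)^{1/p}$ and $\|g\|_{weak\text{-}L_p}=\sup_{\lambda>0}\lambda\,\mu(|g|>\lambda)^{1/p}$. Let $\mathcal F_n$ be the $\sigma$-algebra generated by the sets $I_n(x)$, $x\in G_m$. A martingale is a sequence $f=(f^{(n)}:n\in\mathbb{N})$ of integrable functions with $f^{(n)}$ $\mathcal F_n$-measurable and $S_{M_n}f^{(l)}=f^{(n)}$ for $n\le l$. $f^*=\sup_n|f^{(n)}|$; $H_p$ ($0<p<\infty$) is the space of martingales with $\|f\|_{H_p}:=\|f^*\|_p<\infty$. For a martingale, $\widehat f(i)=\lim_{k\to\infty}\int_{G_m}f^{(k)}\overline{\psi_i}\,d\mu$ and $S_nf=\sum_{k=0}^{n-1}\widehat f(k)\psi_k$. $T$ means: $T_nf=\frac1{Q_n}\sum_{k=0}^{n-1}q_kS_kf$ with $Q_n=\sum_{k=0}^{n-1}q_k$. An operator $A$ is bounded from $H_p$ to a space $X$ if there is a constant $C$ with $\|Af\|_X\le C\|f\|_{H_p}$ for all $f\in H_p$. *)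

(* Defs.v *)
From HB Require Import structures.
From mathcomp Require Export all_boot all_order all_algebra.
From mathcomp Require Export complex.
From mathcomp Require Export all_classical all_reals all_analysis.
Set Implicit Arguments.
Unset Strict Implicit.
Unset Printing Implicit Defensive.
Export Order.TTheory GRing.Theory Num.Theory.
Export numFieldNormedType.Exports.
Export ComplexField.

Local Open Scope classical_set_scope.
Local Open Scope ring_scope.
Local Open Scope complex_scope.

(* The coordinates live in 'Z_(m k), which is the ring of integers mod m k as
   soon as 2 <= m k.  The sigma-algebra is the Borel one, generated by the open
   sets of the product of the discrete topologies. *)
Definition vilenkin_top (m : nat -> nat) : Type :=
  prod_topology (fun k => discrete_topology 'Z_(m k)).

HB.instance Definition _ (m : nat -> nat) := Topological.on (vilenkin_top m).
HB.instance Definition _ (m : nat -> nat) :=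
  isPointed.Build (vilenkin_top m) (fun k => 0 : 'Z_(m k)).

Definition vilenkin (m : nat -> nat) : Type :=
  g_sigma_algebraType (@open (vilenkin_top m)).

Section Vilenkin.
Variables (R : realType) (m : nat -> nat).
Local Notation G := (vilenkin m).

Definition coord (x : G) (k : nat) : 'Z_(m k) := x k.

Definition translate (a x : G) : G := fun k => coord x k + coord a k.

(* For a probability measure on the Borel sets of G, this says that it is the
   normalized Haar measure. *)
Definition translation_invariant (mu : set G -> \bar R) :=
  forall (a : G) (A : set G), measurable A -> mu (translate a @` A) = mu A.

Definition cylinder (n : nat) (x : G) : set G :=
  [set y | forall k, (k < n)%N -> coord y k = coord x k].

Definition Mprod (k : nat) : nat := (\prod_(j < k) m j)%N.

Definition digit (n k : nat) : nat := ((n %/ Mprod k) %% m k)%N.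

Lemma digit_lt n k : (1 < m k)%N -> (digit n k < m k)%N.
Proof. by move=> mk; rewrite ltn_mod ltnW. Qed.

Lemma digit_sum n : (forall k, (1 < m k)%N) ->
  n = (\sum_(k < n) digit n k * Mprod k)%N.
Proof.
move=> m1.
have MS k : Mprod k.+1 = (Mprod k * m k)%N by rewrite /Mprod big_ord_recr.
have Mgt k : (k < Mprod k)%N.
  elim: k => [|k IH]; first by rewrite /Mprod big_ord0.
  rewrite MS (leq_ltn_trans IH)// ltn_Pmulr ?m1//.
  exact: leq_ltn_trans IH.
have step k : n = (\sum_(j < k) digit n j * Mprod j + n %/ Mprod k * Mprod k)%N.
  elim: k => [|k {1}->]; first by rewrite big_ord0 /Mprod big_ord0 divn1 muln1.
  rewrite big_ord_recr/= -addnA; congr addn.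
  rewrite {1}(divn_eq (n %/ Mprod k) (m k)) MS -divnMA /digit.
  by rewrite mulnDl addnC -mulnA (mulnC (m k)).
by rewrite [LHS](step n) divn_small ?Mgt// mul0n addn0.
Qed.

Definition rademacher (k : nat) (x : G) : R[i] :=
  let t : R := 2 * pi * (nat_of_ord (coord x k))%:R / (m k)%:R in
  cos t +i* sin t.

(* The product over all k reduces to k < n: since 2 ^ k <= Mprod k, the digits of n
   of index at least n are zero. *)
Definition psi (n : nat) (x : G) : R[i] :=
  \prod_(k < n) rademacher k x ^+ digit n k.

Variable mu : probability G R.

Definition cintegrable (f : G -> R[i]) :=
  mu.-integrable setT (fun x => (complex.Re (f x))%:E) /\
  mu.-integrable setT (fun x => (complex.Im (f x))%:E).

Definition cintegral (f : G -> R[i]) : R[i] :=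
  (\int[mu]_x complex.Re (f x)) +i* (\int[mu]_x complex.Im (f x)).

Definition fourier (f : G -> R[i]) (i : nat) : R[i] :=
  cintegral (fun x => f x * (psi i x)^*).

Definition partial_sum (c : nat -> R[i]) (n : nat) (x : G) : R[i] :=
  \sum_(k < n) c k * psi k x.

Definition filtration_measurable (n : nat) (f : G -> R[i]) :=
  let Fn := g_sigma_algebraType (range (cylinder n)) in
  measurable_fun [set: Fn] (fun x : Fn => complex.Re (f x)) /\
  measurable_fun [set: Fn] (fun x : Fn => complex.Im (f x)).

Definition martingale (f : nat -> G -> R[i]) :=
  [/\ forall n, cintegrable (f n),
      forall n, filtration_measurable n (f n) &
      forall n l, (n <= l)%N -> partial_sum (fourier (f l)) (Mprod n) = f n].

Definition mfourier (f : nat -> G -> R[i]) (i : nat) : R[i] :=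
  lim ((fun k => fourier (f k) i : R[i]^o) @ \oo).

Definition msum (f : nat -> G -> R[i]) (n : nat) : G -> R[i] :=
  partial_sum (mfourier f) n.

Definition cabs (g : G -> R[i]) (x : G) : \bar R := (Normc.normc (g x))%:E.

Definition maximal (f : nat -> G -> R[i]) (x : G) : \bar R :=
  ereal_sup (range (fun n => cabs (f n) x)).

Definition hardy_norm (p : R) (f : nat -> G -> R[i]) : \bar R :=
  'N[mu]_p%:E[maximal f].

Definition hardy (p : R) (f : nat -> G -> R[i]) :=
  martingale f /\ (hardy_norm p f < +oo)%E.

Definition weak_norm (p : R) (g : G -> \bar R) : \bar R :=
  ereal_sup [set (l%:E * (mu [set x | l%:E < `|g x|] `^ p^-1))%E | l in `]0, +oo[].

(* The operator A is given through its modulus, which may be infinite. *)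
Definition bounded_from_hardy (p : R) (normX : (G -> \bar R) -> \bar R)
    (A : (nat -> G -> R[i]) -> G -> \bar R) :=
  exists C : R, forall f, hardy p f -> (normX (A f) <= C%:E * hardy_norm p f)%E.

Definition Qsum (q : nat -> R) (n : nat) : R := \sum_(k < n) q k.

Definition Tmean (q : nat -> R) (n : nat) (f : nat -> G -> R[i]) (x : G) : R[i] :=
  ((Qsum q n)^-1)%:C * \sum_(k < n) (q k)%:C * msum f k x.

Definition Tmaximal (q : nat -> R) (f : nat -> G -> R[i]) (x : G) : \bar R :=
  ereal_sup [set cabs (Tmean q n f) x | n in [set n | (0 < n)%N]].

End Vilenkin.

(* Main.v *)
(* For part a), summation by parts bounds T_n f by a constant times the maximal
   Fejer means of f: q is monotone and n q_(n-1) / Q_n is bounded.  At a height l,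
   the martingale is split by predictable stopping at the levels 4^k e, with e
   proportional to l, into a part of size at most e and atoms of size 4^k e carried
   by cells of G_m.  The Fejer kernel is dominated by a sum of indicators of sets on
   which all coordinates below A but one vanish; this controls the means of the
   bounded part, and those of an atom at every point.  The contributions of the atoms
   truncated at height l are summed in L_1, and sum_k 2^k mu(f* > 4^k e) is at most
   the integral of 2 sqrt(f* / e).  Everything takes place at a finite level N, where
   integrals are averages over the M_N cells, and N tends to infinity only at the end.

   For part b), S_n f is recovered from T_n f and T_(n+1) f at the cost of a factor n,
   so uniform weak-L_p bounds on the means force the Fourier coefficient of index M_k
   to be O(M_k).  For p < 1/2 the martingale whose coefficients equal M_k^(1/(2p)) on
   [M_k, M_(k+1)) lies in H_p and violates this. *)

(* The obstacle in part a) is the endpoint exponent: the maximal Fejer means of an atom are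
   controlled only in weak-L_(1/2), whose quasi-norm obeys no triangle inequality that would let the
   atoms be added up. Truncation replaces it. Once the bounded part stays below l/2, an excess over
   l forces the atoms to contribute more than l/2; since u -> min(u, l/2) is subadditive on [0, oo),
   the truncated contributions still add up to l/2, and Chebyshev's inequality in L_1 applies.
   Stopping before a jump keeps each stopped martingale below its level. The price is a factor B in
   measure, as at least one of at most B children carries the jump. In part b), coefficients M_k^a
   on the k-th block give a martingale in H_p if a < 1/p - 1, and break the bound O(M_k) if a > 1.
   Such an a exists exactly for p < 1/2, and 1/(2p) is the midpoint. *)
Require Import Defs.
From mathcomp Require Import ring lra zify.
From mathcomp Require Import measurable_realfun.
Set Implicit Arguments.
Unset Strict Implicit.
Unset Printing Implicit Defensive.

Local Open Scope classical_set_scope.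
Local Open Scope ring_scope.
Local Open Scope complex_scope.

(** * Points of the group, cells, and sums over the cells of one level *)

Section Points.
Variable m : nat -> nat.
Hypothesis m_ge2 : forall k, (2 <= m k)%N.
Local Notation G := (vilenkin m).
Local Notation M := (Mprod m).

Definition vzero : G := fun k => 0 : 'Z_(m k).
Definition vsub (x u : G) : G := fun k => coord x k - coord u k.
Definition upd (x : G) n (c : 'Z_(m n)) : G := @dfwith nat (fun k => 'Z_(m k)) (coord x) n c.
Arguments upd : clear implicits.

Definition shift (x : G) n (c : 'Z_(m n)) : G := upd x n (coord x n + c).
Arguments shift : clear implicits.

(** One point per cell of level n, the one whose coordinates from n on vanish. A sum over [reps n]
    divided by [M n] stands for the Haar integral of a function of level n. *)
Fixpoint reps (n : nat) : seq G :=
  if n is k.+1 then [seq upd u k c | u <- reps k, c <- enum 'Z_(m k)]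
  else [:: vzero].

Definition agree (n : nat) (x y : G) := forall k, (k < n)%N -> coord x k = coord y k.

(** Finite form of measurability with respect to the n-th sigma-algebra of the filtration. *)
Definition level (V : Type) (n : nat) (F : G -> V) :=
  forall x y, agree n x y -> F x = F y.

Lemma MprodS k : M k.+1 = (M k * m k)%N.
Proof. by rewrite /Mprod big_ord_recr. Qed.

Lemma Mprod0 : M 0 = 1%N. Proof. by rewrite /Mprod big_ord0. Qed.

Lemma Mprod_gt0 k : (0 < M k)%N.
Proof. by rewrite /Mprod prodn_gt0// => i; apply: ltnW. Qed.

Lemma Mprod_double k : (2 * M k <= M k.+1)%N.
Proof. by rewrite MprodS mulnC leq_mul2l m_ge2 orbT. Qed.

Lemma leq_Mprod i j : (i <= j)%N -> (M i <= M j)%N.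
Proof.
elim: j => [|j IH]; first by rewrite leqn0 => /eqP ->.
rewrite leq_eqVlt => /predU1P[->//|/IH/leq_trans]; apply.
by apply: leq_trans (Mprod_double j); rewrite leq_pmull.
Qed.

Lemma upd_in x n c : coord (upd x n c) n = c.
Proof. exact: (@dfwith_in nat (fun k => 'Z_(m k)) (coord x)). Qed.

Lemma upd_out x n c k : k != n -> coord (upd x n c) k = coord x k.
Proof.
by rewrite eq_sym; apply: (@dfwith_out nat (fun k => 'Z_(m k)) (coord x)).
Qed.

Lemma coord_ext (x y : G) : (forall k, coord x k = coord y k) -> x = y.
Proof. by move=> xy; apply: functional_extensionality_dep. Qed.

Lemma card_Zm k : #|{: 'Z_(m k)}| = m k.
Proof. by rewrite card_ord Zp_cast. Qed.

Lemma agree_sym n x y : agree n x y -> agree n y x.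
Proof. by move=> xy k kn; rewrite xy. Qed.

Lemma agree_trans n x y z : agree n x y -> agree n y z -> agree n x z.
Proof. by move=> xy yz k kn; rewrite xy// yz. Qed.

Lemma agreeW n k x y : (k <= n)%N -> agree n x y -> agree k x y.
Proof. by move=> kn xy j jk; rewrite xy// (leq_trans jk). Qed.

Lemma agree_upd n x c : agree n (upd x n c) x.
Proof. by move=> k kn; rewrite upd_out// neq_ltn kn. Qed.

Lemma agree_updS n x y c : agree n x y -> agree n.+1 (upd x n c) (upd y n c).
Proof.
move=> xy k; have [->|kn] := eqVneq k n; first by rewrite !upd_in.
by rewrite ltnS => kn'; rewrite !upd_out// xy// ltn_neqAle kn.
Qed.

Lemma agree_upd_coord n x : agree n.+1 (upd x n (coord x n)) x.
Proof.
move=> k _; have [->|kn] := eqVneq k n; first by rewrite !upd_in.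
by rewrite upd_out.
Qed.

Lemma translate_vsub x u : translate u (vsub x u) = x.
Proof. by apply: coord_ext => k; rewrite /coord /translate /vsub /coord subrK. Qed.

Lemma coord_translate (a x : G) k : coord (translate a x) k = coord x k + coord a k.
Proof. by []. Qed.

Lemma coord_vsub (x u : G) k : coord (vsub x u) k = coord x k - coord u k.
Proof. by []. Qed.

Section Sums.
Variable V : nmodType.

Lemma sum_repsS n (F : G -> V) :
  \sum_(u <- reps n.+1) F u = \sum_(u <- reps n) \sum_(c : 'Z_(m n)) F (upd u n c).
Proof. by rewrite big_allpairs_dep/=; apply: eq_bigr => u _; rewrite big_enum. Qed.

(** Discrete invariance of the Haar measure. A translation permutes the cells but may move a point
    out of the list [reps n]; the level hypothesis absorbs this. *)
Lemma sum_reps_translate n a (F : G -> V) : level n F ->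
  \sum_(u <- reps n) F (translate a u) = \sum_(u <- reps n) F u.
Proof.
elim: n F => [|n IH] F Fn; first by rewrite !big_seq1; apply: Fn => k.
rewrite !sum_repsS -(IH (fun u => \sum_c F (upd u n c))); last first.
  by move=> x y xy; apply: eq_bigr => c _; apply/Fn/agree_updS.
apply: eq_bigr => u _; rewrite [RHS](reindex_inj (addIr (coord a n)))/=.
apply: eq_bigr => c _; apply: Fn => k; rewrite ltnS leq_eqVlt => kn.
have [E|kn'] := eqVneq k n.
  by subst k; rewrite coord_translate !upd_in.
by rewrite coord_translate !upd_out.
Qed.

Lemma sum_reps_shift n k (c : 'Z_(m k)) (F : G -> V) : level n F ->
  \sum_(u <- reps n) F (shift u k c) = \sum_(u <- reps n) F u.
Proof.
move=> Fn; rewrite -[RHS](sum_reps_translate (upd vzero k c) Fn).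
apply: eq_bigr => u _; congr F; apply: coord_ext => j.
rewrite coord_translate /shift.
have [E|jk] := eqVneq j k; first by subst j; rewrite !upd_in.
by rewrite !upd_out// [coord vzero j]/(0 : 'Z_(m j)) addr0.
Qed.

Lemma sum_reps_const n (v : V) : \sum_(u <- reps n) v = v *+ M n.
Proof.
elim: n => [|n IH]; first by rewrite big_seq1 Mprod0.
rewrite sum_repsS (eq_bigr (fun _ => v *+ m n)); last first.
  by move=> u _; rewrite sumr_const card_Zm.
by rewrite sumrMnl IH MprodS mulrnA.
Qed.

(** The averages at levels n and N agree; cross-multiplied so as to hold in any commutative
    monoid. *)
Lemma sum_reps_level n N (F : G -> V) : (n <= N)%N -> level n F ->
  (\sum_(u <- reps N) F u) *+ M n = (\sum_(u <- reps n) F u) *+ M N.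
Proof.
move=> + Fn; elim: N => [|N IH]; first by rewrite leqn0 => /eqP ->.
rewrite leq_eqVlt => /predU1P[->//|nN].
rewrite sum_repsS (eq_bigr (fun u => F u *+ m N)); last first.
  move=> u _; rewrite -[in RHS]card_Zm -sumr_const; apply: eq_bigr => c _.
  by apply: Fn; apply: (@agreeW N) => //; exact: agree_upd.
by rewrite sumrMnl mulrnAC IH// MprodS mulrnA.
Qed.

End Sums.

Definition samecyl n (x y : G) : bool := [forall k : 'I_n, coord x k == coord y k].

Lemma samecylP n x y : reflect (agree n x y) (samecyl n x y).
Proof.
apply: (iffP forallP) => [h k kn|h k]; first by have /eqP := h (Ordinal kn).
by apply/eqP/h.
Qed.

Lemma samecylS n x y : samecyl n.+1 x y = samecyl n x y && (coord x n == coord y n).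
Proof.
apply/samecylP/andP => [h|[/samecylP h /eqP e] k].
  by split; [apply/samecylP => k kn; apply: h; exact: ltnW|apply/eqP/h].
by rewrite ltnS leq_eqVlt => /predU1P[->//|/h].
Qed.

Lemma level_samecyl n i z : (i <= n)%N -> level n (fun u => samecyl i u z).
Proof.
move=> ni x y /(agreeW ni) xy; apply/samecylP/samecylP; apply: agree_trans => //.
exact: agree_sym.
Qed.

Lemma samecylC n x y : samecyl n x y = samecyl n y x.
Proof. by apply/samecylP/samecylP => /agree_sym. Qed.

Section Products.
Variable A : comPzSemiRingType.

Lemma sum_reps_prod n (phi : forall k, 'Z_(m k) -> A) :
  \sum_(u <- reps n) \prod_(k < n) phi k (coord u k) =
  \prod_(k < n) \sum_(c : 'Z_(m k)) phi k c.
Proof.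
elim: n => [|n IH]; first by rewrite big_seq1 !big_ord0.
rewrite sum_repsS big_ord_recr/= -IH mulr_suml; apply: eq_bigr => u _.
rewrite mulr_sumr; apply: eq_bigr => c _; rewrite big_ord_recr/= upd_in.
by congr (_ * _); apply: eq_bigr => k _; rewrite upd_out// neq_ltn ltn_ord.
Qed.

(** The number of listed points in the cell of x factors over the coordinates, and each factor is
    1. *)
Lemma sum_reps_decomp n (F : G -> A) x : level n F ->
  \sum_(u <- reps n) (samecyl n u x)%:R * F u = F x.
Proof.
move=> Fn; rewrite (eq_bigr (fun u => (samecyl n u x)%:R * F x)); last first.
  by move=> u _; case: samecylP => [/Fn ->//|]; rewrite !mul0r.
rewrite -mulr_suml (eq_bigr (fun u => \prod_(k < n) (coord u k == coord x k)%:R)).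
  rewrite (sum_reps_prod _ (fun k c => (c == coord x k)%:R)) big1 ?mul1r// => k _.
  by rewrite (bigD1 (coord x k))//= eqxx big1 ?addr0// => c /negPf ->.
move=> u _; elim: n {Fn} => [|n IH].
  by rewrite big_ord0; case: samecylP => // -[].
rewrite big_ord_recr/= -IH samecylS.
by case: samecyl; case: eqP; rewrite ?mulr0 ?mul0r ?mulr1.
Qed.

End Products.

End Points.

(** * The Vilenkin system: roots of unity, block structure, orthogonality *)

Section Characters.
Variables (R : realType) (m : nat -> nat).
Hypothesis m_ge2 : forall k, (2 <= m k)%N.
Local Notation G := (vilenkin m).
Local Notation M := (Mprod m).
Local Notation normc := (@Normc.normc R).
Local Notation rad := (rademacher R).
Local Notation psi := (psi R).

Lemma normcE z : `|z| = (normc z)%:C :> R[i].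
Proof. by []. Qed.

Lemma normc_ge0 z : 0 <= normc z.
Proof. by rewrite -lecR -normcE normr_ge0. Qed.

Lemma normcD x y : normc (x + y) <= normc x + normc y.
Proof. by rewrite -lecR rmorphD/= -!normcE ler_normD. Qed.

Lemma normcM x y : normc (x * y) = normc x * normc y.
Proof. exact: Normc.normcM. Qed.

Lemma normcN x : normc (- x) = normc x.
Proof. by case: x => a b; rewrite /Normc.normc/= !sqrrN. Qed.

Lemma normcB x y : normc (x - y) <= normc x + normc y.
Proof. by rewrite -(normcN y) normcD. Qed.

Lemma normcX x n : normc (x ^+ n) = normc x ^+ n.
Proof. by elim: n => [|n IH]; rewrite ?Normc.normc1// !exprS normcM IH. Qed.

Lemma normcC (r : R) : normc r%:C = `|r|.
Proof. by rewrite /Normc.normc/= expr0n addr0 sqrtr_sqr. Qed.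

Lemma normc_sum I (s : seq I) (P : pred I) (F : I -> R[i]) :
  normc (\sum_(i <- s | P i) F i) <= \sum_(i <- s | P i) normc (F i).
Proof.
elim/big_ind2 : _ => [|x1 x2 y1 y2 h1 h2|//]; first by rewrite Normc.normc0.
by apply: le_trans (normcD _ _) _; rewrite lerD.
Qed.

Definition unit_root (k c : nat) : R[i] :=
  let t : R := 2 * pi * c%:R / (m k)%:R in cos t +i* sin t.

Lemma m_gt0 k : (0 < m k)%N. Proof. exact: ltnW. Qed.

Lemma mR_neq0 k : (m k)%:R != 0 :> R.
Proof. by rewrite pnatr_eq0 -lt0n m_gt0. Qed.

Lemma rootD k c d : unit_root k (c + d) = unit_root k c * unit_root k d.
Proof.
rewrite /unit_root natrD mulrDr mulrDl cosD sinD.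
by apply/eqP; rewrite eq_complex/= eqxx/= [X in _ == X]addrC mulrC [X in _ + X]mulrC eqxx.
Qed.

Lemma root0 k : unit_root k 0 = 1.
Proof. by rewrite /unit_root mulr0 mul0r cos0 sin0. Qed.

Lemma root_m k : unit_root k (m k) = 1.
Proof. by rewrite /unit_root mulfK ?mR_neq0// mulr_natl cos2pi sin2pi. Qed.

Lemma rootM k c d : unit_root k (c * d) = unit_root k c ^+ d.
Proof.
elim: d => [|d IH]; first by rewrite muln0 root0 expr0.
by rewrite mulnS rootD IH exprS.
Qed.

Lemma root_mod k c : unit_root k (c %% m k) = unit_root k c.
Proof.
rewrite {2}(divn_eq c (m k)) rootD mulnC rootM root_m expr1n mul1r //.
Qed.

(** The half angle u lies strictly between 0 and pi, so sin u > 0 and cos 2u = 1 - 2 sin^2 u < 1. *)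
Lemma root_neq1 k c : (0 < c < m k)%N -> unit_root k c != 1.
Proof.
move=> /andP[c0 cm]; apply/negP => /eqP [].
set t := (X in cos X); have -> : t = (pi * c%:R / (m k)%:R) *+ 2 by rewrite /t; ring.
have m0 : (0 : R) < (m k)%:R by rewrite ltr0n m_gt0.
set u := pi * _ / _.
have su : 0 < sin u.
  apply: sin_gt0_pi; rewrite /u; apply/andP; split.
    by rewrite divr_gt0// mulr_gt0 ?pi_gt0// ltr0n.
  by rewrite ltr_pdivrMr// ltr_pM2l ?pi_gt0// ltr_nat.
rewrite cos_mulr2n => e _.
have := cos2Dsin2 u; nra.
Qed.

Lemma normc_root k c : normc (unit_root k c) = 1.
Proof. by rewrite /Normc.normc /unit_root cos2Dsin2 sqrtr1. Qed.

Lemma root_conj k c : unit_root k c * Num.conj (unit_root k c) = 1.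
Proof.
rewrite -[Num.conj _]/(conjc _); apply/eqP; rewrite eq_complex/=; set t := (X in cos X).
rewrite mulrN opprK -!expr2 cos2Dsin2 eqxx/=.
by rewrite mulrN mulrC addrC subrr.
Qed.

Lemma rademacherE k (x : G) : rad k x = unit_root k (coord x k).
Proof. by []. Qed.

Lemma sum_root k c : \sum_(b < m k) unit_root k c ^+ b = (if (m k %| c)%N then m k else 0%N)%:R.
Proof.
case: ifPn => mc.
  rewrite (eq_bigr (fun=> 1)) ?sumr_const ?card_ord// => b _.
  by rewrite -root_mod (eqP mc) root0 expr1n.
have r1 : unit_root k c != 1.
  rewrite -root_mod root_neq1// ltn_mod m_gt0 andbT lt0n; exact: mc.
apply: (@mulfI _ (unit_root k c - 1)); first by rewrite subr_eq0.
by rewrite -subrX1 -rootM mulnC rootM root_m expr1n subrr mulr0.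
Qed.

Lemma sum_Zm (V : nmodType) k (F : nat -> V) : \sum_(c : 'Z_(m k)) F c = \sum_(b < m k) F b.
Proof. by rewrite -(big_mkord xpredT) /= Zp_cast// big_mkord. Qed.

Lemma sum_rad_pow k (x : G) :
  \sum_(b < m k) rad k x ^+ b = (if coord x k == 0 then m k else 0%N)%:R.
Proof.
rewrite rademacherE sum_root; congr (_%:R); congr (if _ then _ else _).
have lt : (coord x k < m k)%N by rewrite -[X in (_ < X)%N](Zp_cast (m_ge2 k)).
apply/idP/eqP => [|->]; last by rewrite dvdn0.
rewrite /dvdn modn_small// => /eqP e; exact: val_inj.
Qed.

(** Conjugating a j-th power gives the power m_k - j, so this is a sum of powers of one root of
    unity, nonzero only when m_k divides i + (m_k - j). *)
Lemma root_orth k i j : (i < m k)%N -> (j < m k)%N ->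
  \sum_(c : 'Z_(m k)) unit_root k c ^+ i * Num.conj (unit_root k c ^+ j) = (if i == j then m k else 0%N)%:R.
Proof.
move=> im jm.
rewrite (sum_Zm k (fun c => unit_root k c ^+ i * Num.conj (unit_root k c ^+ j))).
have cj c : Num.conj (unit_root k c ^+ j) = unit_root k c ^+ (m k - j).
  apply: (@mulfI _ (unit_root k c ^+ j)).
    by rewrite expf_neq0//; apply/eqP => /(congr1 normc)/eqP; rewrite normc_root Normc.normc0 oner_eq0.
  rewrite rmorphXn/= -exprMn root_conj expr1n -exprD subnKC ?(ltnW jm)//.
  by rewrite -rootM mulnC rootM root_m expr1n.
rewrite (eq_bigr (fun c : 'I_(m k) => unit_root k (i + (m k - j)) ^+ c)); last first.
  by move=> c _; rewrite cj -exprD -!rootM mulnC.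
rewrite sum_root; congr (_%:R); congr (if _ then _ else _).
apply/idP/eqP => [|->]; last by rewrite subnKC ?dvdnn// ltnW.
move: im jm; case: (ltngtP i j) => // ij im jm.
  by rewrite /dvdn modn_small; lia.
have -> : (i + (m k - j) = m k + (i - j))%N by lia.
by rewrite dvdn_addr// /dvdn modn_small; lia.
Qed.

Lemma ltn_Mprod k : (k < M k)%N.
Proof.
elim: k => [|k IH]; first by rewrite Mprod0.
by have := Mprod_double m_ge2 k; lia.
Qed.

Lemma digit_small n k : (n < M k)%N -> digit m n k = 0%N.
Proof. by move=> nk; rewrite /digit divn_small// mod0n. Qed.

Lemma psi_widen n s t (x : G) : (n < M s)%N -> (s <= t)%N ->
  \prod_(k < t) rad k x ^+ digit m n k = \prod_(k < s) rad k x ^+ digit m n k.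
Proof.
move=> ns; elim: t => [|t IH]; first by rewrite leqn0 => /eqP ->.
rewrite leq_eqVlt => /predU1P[<-//|st].
rewrite big_ord_recr/= IH// digit_small ?expr0 ?mulr1//.
by apply: leq_trans ns _; apply: leq_Mprod.
Qed.

Lemma psiE n s (x : G) : (n < M s)%N -> psi n x = \prod_(k < s) rad k x ^+ digit m n k.
Proof.
move=> ns; rewrite /Defs.psi; have [h|h] := leqP n s; first by rewrite -(psi_widen x (ltn_Mprod n) h).
by rewrite (psi_widen x ns (ltnW h)).
Qed.

Lemma normc_psi n (x : G) : normc (psi n x) = 1.
Proof.
rewrite /Defs.psi; elim/big_rec: _ => [|k z _ IH]; first exact: Normc.normc1.
by rewrite normcM normcX rademacherE normc_root expr1n IH mul1r.
Qed.

Lemma psi0 (x : G) : psi 0 x = 1.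
Proof. by rewrite /Defs.psi big_ord0. Qed.

Lemma level_rad n k : (k < n)%N -> level n (@rademacher R m k).
Proof. by move=> kn x y /(_ k kn) e; rewrite !rademacherE e. Qed.

Lemma level_psi n s : (n < M s)%N -> level s (psi (m:=m) n).
Proof.
move=> ns x y xy; rewrite !(psiE _ ns); apply: eq_bigr => k _.
by rewrite (level_rad (ltn_ord k) xy).
Qed.

Lemma radD k (a x : G) : rad k (translate a x) = rad k x * rad k a.
Proof.
rewrite !rademacherE -rootD coord_translate -[RHS]root_mod; congr unit_root => /=.
by congr (_ %% _)%N; exact: Zp_cast.
Qed.

Lemma psiD n (a x : G) : psi n (translate a x) = psi n x * psi n a.
Proof. by rewrite /Defs.psi -big_split/=; apply: eq_bigr => k _; rewrite radD exprMn. Qed.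

Lemma digit_block A b j k : (j < M A)%N -> (b < m A)%N -> (k <= A)%N ->
  digit m (b * M A + j) k = if (k == A)%N then b else digit m j k.
Proof.
move=> jA bA; rewrite leq_eqVlt => /predU1P[->|kA].
  by rewrite eqxx /digit divnMDl ?Mprod_gt0// divn_small// addn0 modn_small.
rewrite (ltn_eqF kA) /digit.
have [d dE] : exists d, M A = (d * (M k * m k))%N.
  have: (M k.+1 %| M A)%N.
    elim: A kA {jA bA} => // A IH; rewrite ltnS leq_eqVlt => /predU1P[->//|/IH h].
    by rewrite (MprodS m A) dvdn_mulr.
  by rewrite MprodS => /dvdnP[d ->]; exists d.
rewrite dE (_ : (b * _ + j = b * d * m k * M k + j)%N); last by ring.
by rewrite divnMDl ?Mprod_gt0// modnMDl.
Qed.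

Lemma block_lt A b j : (j < M A)%N -> (b < m A)%N -> (b * M A + j < M A.+1)%N.
Proof. by move=> jA bA; rewrite MprodS; nia. Qed.

Lemma psi_block A b j (x : G) : (j < M A)%N -> (b < m A)%N ->
  psi (b * M A + j) x = rad A x ^+ b * psi j x.
Proof.
move=> jA bA; rewrite (psiE _ (block_lt jA bA)) (psiE _ jA) big_ord_recr/=.
rewrite digit_block// eqxx mulrC; congr (_ * _).
by apply: eq_bigr => k _; rewrite digit_block// ?(ltnW (ltn_ord k))// (ltn_eqF (ltn_ord k)).
Qed.

Lemma digit_inj s i j : (i < M s)%N -> (j < M s)%N ->
  (forall k, (k < s)%N -> digit m i k = digit m j k) -> i = j.
Proof.
move=> iM jM e.
have w n t : (n < M s)%N -> (s <= t)%N ->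
    (\sum_(k < t) digit m n k * M k = \sum_(k < s) digit m n k * M k)%N.
  move=> ns; elim: t => [|t IH]; first by rewrite leqn0 => /eqP ->.
  rewrite leq_eqVlt => /predU1P[<-//|st].
  rewrite big_ord_recr/= IH// digit_small ?mul0n ?addn0//.
  by apply: leq_trans ns _; apply: leq_Mprod.
have u n : (n < M s)%N -> n = (\sum_(k < s) digit m n k * M k)%N.
  move=> ns; have := w n (n + s)%N ns (leq_addl _ _) => <-.
  rewrite {1}(digit_sum n m_ge2); elim: s {w iM jM ns e} => [|s IH]; first by rewrite addn0.
  rewrite addnS big_ord_recr/= -IH digit_small ?mul0n ?addn0//.
  by apply: leq_trans (ltn_Mprod n) _; apply: leq_Mprod => //; apply: leq_addr.
by rewrite (u i)// (u j)//; apply: eq_bigr => k _; rewrite e.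
Qed.

(** The sum factors over the coordinates; distinct indices differ in some digit, and the factor of
    that digit vanishes. *)
Lemma psi_orth s i j : (i < M s)%N -> (j < M s)%N ->
  \sum_(u <- reps m s) psi i u * Num.conj (psi j u) = (if i == j then M s else 0%N)%:R.
Proof.
move=> iM jM.
pose phi k (c : 'Z_(m k)) := unit_root k c ^+ digit m i k * Num.conj (unit_root k c ^+ digit m j k).
rewrite (eq_bigr (fun u => \prod_(k < s) phi k (coord u k))); last first.
  move=> u _; rewrite (psiE _ iM) (psiE _ jM) rmorph_prod -big_split/=.
  by apply: eq_bigr.
rewrite sum_reps_prod (eq_bigr (fun k : 'I_s => (if digit m i k == digit m j k then m k else 0%N)%:R)); last first.
  by move=> k _; rewrite root_orth// digit_lt.
case: ifPn => [/eqP ->|ij].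
  under eq_bigr do rewrite eqxx.
  by rewrite -natr_prod.
suff /existsP[k kk] : [exists k : 'I_s, digit m i k != digit m j k].
  by rewrite (bigD1 k)//= (negPf kk) mul0r.
rewrite -negb_forall; apply: contra ij => /forallP h; apply/eqP/(digit_inj iM jM).
by move=> k ks; apply/eqP/(h (Ordinal ks)).
Qed.

End Characters.

(** * Dirichlet and Fejer kernels and their pointwise majorant *)

Section Kernels.
Variables (R : realType) (m : nat -> nat) (B : nat).
Hypothesis m_ge2 : forall k, (2 <= m k)%N.
Hypothesis m_leB : forall k, (m k <= B)%N.
Local Notation G := (vilenkin m).
Local Notation M := (Mprod m).
Local Notation normc := (@Normc.normc R).
Local Notation rad := (rademacher R).
Local Notation psi := (psi R).

Definition dirichlet (n : nat) (x : G) : R[i] := \sum_(j < n) psi j x.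
(* n times the Fejer kernel, the mean of D_0, ..., D_(n-1). *)
Definition fejer_sum (n : nat) (x : G) : R[i] := \sum_(k < n) dirichlet k x.

(** For k >= A no index is exempt, and the set is the cell of level A around 0. The case k = A is
    used in this way throughout. *)
Definition Jset (k A : nat) (x : G) : bool :=
  [forall j : 'I_A, (j != k :> nat) ==> (coord x j == 0)].

Lemma JsetP k A x :
  reflect (forall j, (j < A)%N -> j != k -> coord x j = 0) (Jset k A x).
Proof.
apply: (iffP forallP) => [h j jA jk|h j]; last by apply/implyP => jk; apply/eqP/h.
by have /implyP/(_ jk)/eqP := h (Ordinal jA).
Qed.

Lemma JsetS k A x : (k < A)%N -> Jset k A.+1 x = Jset k A x && (coord x A == 0).
Proof.
move=> kA; apply/JsetP/andP => [h|[/JsetP h /eqP e] j].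
  split; first by apply/JsetP => j jA; apply: h; exact: ltnW.
  by apply/eqP/h; rewrite ?ltnSn// gtn_eqF.
by rewrite ltnS leq_eqVlt => /predU1P[->//|/h].
Qed.

Lemma JsetSS A x : Jset A A.+1 x = Jset A A x.
Proof.
apply/JsetP/JsetP => h j jA jk; first by apply: h => //; exact: ltnW.
by apply: h => //; rewrite ltn_neqAle jk -ltnS.
Qed.

Lemma sum_block (V : nmodType) a b n (F : nat -> V) :
  \sum_(k < a * b + n) F k =
  \sum_(i < a) \sum_(j < b) F (i * b + j)%N + \sum_(j < n) F (a * b + j)%N.
Proof.
elim: a n => [|a IH] n; first by rewrite big_ord0 add0r.
rewrite mulSn addnAC addnC IH big_ord_recr/= -addrA; congr (_ + _).
by rewrite big_split_ord/=; congr (_ + _); apply: eq_bigr => j _; congr F; lia.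
Qed.

Lemma dirichlet_block A b j x : (j <= M A)%N -> (b < m A)%N ->
  dirichlet (b * M A + j) x =
  (\sum_(i < b) rad A x ^+ i) * dirichlet (M A) x + rad A x ^+ b * dirichlet j x.
Proof.
move=> jA bA; rewrite /dirichlet (sum_block b (M A) j (fun k => psi k x)); congr (_ + _).
  rewrite mulr_suml; apply: eq_bigr => i _; rewrite mulr_sumr; apply: eq_bigr => l _.
  by rewrite psi_block// (leq_trans (ltn_ord i)) ?(ltnW bA).
rewrite mulr_sumr; apply: eq_bigr => l _.
by rewrite psi_block// (leq_trans (ltn_ord l)).
Qed.

(** Paley's identity. By the block structure of the characters the kernel is a product over k < A of
    sums of powers of [rad k x], each equal to m_k or 0 according to whether x_k vanishes. *)
Lemma dirichlet_Mprod A x : dirichlet (M A) x = (if Jset A A x then M A else 0%N)%:R.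
Proof.
elim: A => [|A IH].
  rewrite Mprod0 /dirichlet big_ord1 psi0; case: JsetP => // h; exfalso; apply: h => j.
  by rewrite ltn0.
rewrite MprodS mulnC -[X in dirichlet X]addn0 /dirichlet.
rewrite (sum_block (m A) (M A) 0 (fun k => psi k x)) big_ord0 addr0.
under eq_bigr => b _ do under eq_bigr => j _ do rewrite psi_block//.
under eq_bigr => b _ do rewrite -mulr_sumr -/(dirichlet (M A) x).
rewrite -mulr_suml sum_rad_pow// IH.
have -> : Jset A.+1 A.+1 x = Jset A A x && (coord x A == 0).
  apply/JsetP/andP => [h|[/JsetP h /eqP e] j].
    split; last by apply/eqP/h; rewrite ?ltnSn// ltn_eqF.
    by apply/JsetP => j jA _; apply: h; [exact: ltnW|rewrite ltn_eqF// ltnW].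
  rewrite ltnS leq_eqVlt => /predU1P[->//|jA _]; apply: h => //.
  by rewrite ltn_eqF.
by case: Jset; case: eqP => _ /=; rewrite ?mul0r ?mulr0// -natrM.
Qed.

(** The second alternative admits the index [M A.+1] itself, made of full blocks only. *)
Lemma fejer_sum_block A a n x : (n <= M A)%N -> (a < m A)%N || (a == m A) && (n == 0)%N ->
  fejer_sum (a * M A + n) x =
  \sum_(b < a) ((M A)%:R * (\sum_(i < b) rad A x ^+ i) * dirichlet (M A) x
                + rad A x ^+ b * fejer_sum (M A) x)
  + (n%:R * (\sum_(i < a) rad A x ^+ i) * dirichlet (M A) x + rad A x ^+ a * fejer_sum n x).
Proof.
move=> nA aA; rewrite /fejer_sum (sum_block a (M A) n (fun k => dirichlet k x)); congr (_ + _).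
  apply: eq_bigr => b _.
  have bA : (b < m A)%N.
    by case/orP: aA => [aA|/andP[/eqP <- _]//]; apply: leq_trans (ltn_ord b) (ltnW aA).
  under eq_bigr => j _ do rewrite dirichlet_block ?(ltnW (ltn_ord j))//.
  by rewrite big_split/= sumr_const card_ord -mulr_sumr -(mulr_natl (_ * _)) mulrA.
case/orP: aA => [aA|/andP[_ /eqP ->]]; last first.
  by rewrite !big_ord0 !mul0r mulr0 addr0.
under eq_bigr => j _ do rewrite dirichlet_block ?(leq_trans (ltnW (ltn_ord j)))//.
by rewrite big_split/= sumr_const card_ord -mulr_sumr -(mulr_natl (_ * _)) mulrA.
Qed.

Lemma normc_nat n : normc n%:R = n%:R.
Proof. by rewrite -(rmorph_nat (real_complex R)) normcC normr_nat. Qed.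

Lemma normc_radX A b (x : G) : normc (rad A x ^+ b) = 1.
Proof. by rewrite normcX rademacherE normc_root expr1n. Qed.

Lemma normc_geom A b (x : G) : normc (\sum_(i < b) rad A x ^+ i) <= b%:R.
Proof.
apply: le_trans (normc_sum _ _ _) _.
by under eq_bigr do rewrite normc_radX; rewrite sumr_const card_ord.
Qed.

(** Passing from A to A + 1, the old kernel is multiplied by the sum of the powers of [rad A x].
    This vanishes unless x_A = 0, which turns the sets for A into those for A + 1. The Dirichlet
    terms supply the new set, with exceptional index A. *)
Lemma fejer_sum_Mprod A x :
  normc (fejer_sum (M A) x) <= (B * M A)%:R * \sum_(k < A) (M k)%:R * (Jset k A x)%:R.
Proof.
elim: A => [|A IH].
  rewrite Mprod0 /fejer_sum big_ord1 /dirichlet !big_ord0 Normc.normc0.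
  by rewrite mulr_ge0 ?sumr_ge0.
rewrite [X in fejer_sum X](_ : _ = m A * M A + 0)%N; last by rewrite MprodS mulnC addn0.
rewrite fejer_sum_block ?eqxx ?orbT// mulr0n !mul0r add0r.
rewrite [fejer_sum 0 x]/fejer_sum big_ord0 mulr0 addr0 big_split/= -[X in _ + X]mulr_suml.
rewrite sum_rad_pow//.
apply: le_trans (normcD _ _) _; rewrite big_ord_recr/= mulrDr addrC.
rewrite normcM normc_nat JsetSS lerD//.
  apply: (@le_trans _ _ ((if coord x A == 0 then m A else 0)%:R *
      ((B * M A)%:R * \sum_(k < A) (M k)%:R * (Jset k A x)%:R))).
    by rewrite ler_wpM2l.
  case: eqP => [x0|_]; last first.
    by rewrite mulr0n mul0r !mulr_ge0 ?sumr_ge0// => k _; rewrite mulr_ge0.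
  rewrite mulrA -natrM (_ : (m A * (B * M A) = B * M A.+1)%N); last by rewrite MprodS; ring.
  rewrite ler_wpM2l//.
  by apply: ler_sum => k _; rewrite ler_wpM2l// JsetS// x0 eqxx andbT.
rewrite dirichlet_Mprod; case: ifP => _; last first.
  by under eq_bigr do rewrite mulr0; rewrite sumr_const mul0rn Normc.normc0 !mulr0.
apply: le_trans (normc_sum _ _ _) _.
apply: (@le_trans _ _ (\sum_(b < m A) (M A * B * M A)%:R)).
  apply: ler_sum => b _; rewrite !normcM !normc_nat !natrM ler_wpM2r// ler_wpM2l//.
  apply: le_trans (normc_geom _ _ _) _; rewrite ler_nat.
  exact: leq_trans (ltnW (ltn_ord b)) (m_leB A).
rewrite sumr_const card_ord MprodS mulr1 -natrM -mulrnA ler_nat; apply/eq_leq; ring.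
Qed.

Definition fejer_majorant (s : nat) (x : G) : R :=
  \sum_(A < s) \sum_(k < A.+1) (M k)%:R * (M A)%:R * (Jset k A x)%:R.

Lemma fejer_majorant_ge0 s x : 0 <= fejer_majorant s x.
Proof. by rewrite !sumr_ge0// => A _; rewrite sumr_ge0. Qed.

(** Induction on the number of digits, removing the leading digit a. The a full blocks and the
    remainder cost a + 1 <= B copies of the new terms, so the constant B^2 does not grow. *)
Lemma fejer_sum_le s n x : (n < M s)%N -> normc (fejer_sum n x) <= (B ^ 2)%:R * fejer_majorant s x.
Proof.
elim: s n => [|s IH] n.
  by rewrite Mprod0 ltnS leqn0 => /eqP ->; rewrite /fejer_sum big_ord0 Normc.normc0
    mulr_ge0// fejer_majorant_ge0.
move=> nS; set a := (n %/ M s)%N; set l := (n %% M s)%N.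
have ls : (l < M s)%N by rewrite ltn_mod Mprod_gt0.
have am : (a < m s)%N by rewrite ltn_divLR ?Mprod_gt0// mulnC -MprodS.
rewrite (divn_eq n (M s)) -/a -/l fejer_sum_block ?am// ?(ltnW ls)//.
rewrite /fejer_majorant big_ord_recr/= -/(fejer_majorant s x) mulrDr addrC big_ord_recr/=.
have aB : (a.+1 <= B)%N := leq_trans am (m_leB s).
set d := \sum_(k < s) _.
have d0 : 0 <= d by rewrite sumr_ge0.
have nD : normc (dirichlet (M s) x) = (M s)%:R * (Jset s s x)%:R.
  by rewrite dirichlet_Mprod normc_nat; case: Jset; rewrite ?mulr1 ?mulr0.
set D := normc _ in nD.
have D0 : 0 <= D by exact: normc_ge0.
have main : normc (\sum_(b < a) ((M s)%:R * (\sum_(i < b) rad s x ^+ i) * dirichlet (M s) x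
                + rad s x ^+ b * fejer_sum (M s) x))
     <= a%:R * ((M s)%:R * B%:R * D + B%:R * d).
  apply: le_trans (normc_sum _ _ _) _.
  apply: (@le_trans _ _ (\sum_(b < a) ((M s)%:R * B%:R * D + B%:R * d))); last first.
    by rewrite sumr_const card_ord [leRHS]mulr_natl.
  apply: ler_sum => b _; apply: le_trans (normcD _ _) _; apply: lerD.
    rewrite !normcM normc_nat ler_wpM2r// ler_wpM2l//.
    apply: le_trans (normc_geom _ _ _) _; rewrite ler_nat.
    by apply: leq_trans (ltnW (ltn_ord b)) _; apply: ltnW.
  rewrite normcM normc_radX mul1r; apply: le_trans (fejer_sum_Mprod _ _) _.
  rewrite natrM -mulrA ler_wpM2l// mulr_sumr; apply: ler_sum => k _.
  by rewrite mulrA (mulrC (M s)%:R).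
have rest : normc (l%:R * (\sum_(i < a) rad s x ^+ i) * dirichlet (M s) x + rad s x ^+ a * fejer_sum l x)
   <= (M s)%:R * B%:R * D + (B ^ 2)%:R * fejer_majorant s x.
  apply: le_trans (normcD _ _) _; rewrite !normcM normc_nat normc_radX mul1r lerD ?IH//.
  rewrite -/D ler_wpM2r// ler_pM ?normc_ge0//; first by rewrite ler_nat ltnW.
  by apply: le_trans (normc_geom _ _ _) _; rewrite ler_nat ltnW.
apply: le_trans (normcD _ _) _; apply: le_trans (lerD rest main) _.
have -> : (M s)%:R * (M s)%:R * (Jset s s x)%:R = (M s)%:R * D by rewrite nD mulrA.
rewrite natrX.
have Bge : a%:R + 1 <= B%:R :> R by rewrite natr1 ler_nat.
have a0 : 0 <= a%:R :> R by [].
have H1 : (a%:R + 1) * (B%:R * ((M s)%:R * D)) <= B%:R * (B%:R * ((M s)%:R * D)) :> R.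
  by rewrite ler_wpM2r// !mulr_ge0.
have H2 : a%:R * (B%:R * d) <= B%:R * (B%:R * d) by rewrite ler_wpM2r ?mulr_ge0//; lra.
lra.
Qed.

(** All coordinates of t below A are prescribed except at most one, and the free one has at most B
    values. *)
Lemma Jset_measure N k A x : (A <= N)%N ->
  (\sum_(t <- reps m N) (Jset k A (vsub x t))%:R) * (M A)%:R <= (B * M N)%:R :> R.
Proof.
move=> AN.
pose phi j (c : 'Z_(m j)) : R :=
  if (j < A)%N && (j != k) then (c == coord x j)%:R else 1.
rewrite (eq_bigr (fun t => \prod_(j < N) phi j (coord t j))); last first.
  move=> t _; case: JsetP => [h|h].
    rewrite big1// => j _; rewrite /phi; case: andP => // -[jA jk].
    by have /eqP := h j jA jk; rewrite coord_vsub subr_eq0 eq_sym => ->.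
  have /existsP[j jk] : [exists j : 'I_N, (j < A)%N && (j != k :> nat) && (coord t j != coord x j)].
    apply/negbNE/negP => /existsPn n; apply: h => j jA jk.
    have := n (Ordinal (leq_trans jA AN)); rewrite /= jA jk/= negbK coord_vsub => /eqP ->.
    by rewrite subrr.
  case/andP: jk => jk tx.
  by rewrite (bigD1 j)//= /phi jk (negPf tx) mul0r.
rewrite sum_reps_prod.
have -> : (M A)%:R = \prod_(j < N) (if (j < A)%N then (m j)%:R else 1) :> R.
  rewrite /Mprod natr_prod -(big_mkord xpredT (fun j => (m j)%:R)).
  rewrite -(big_mkord xpredT (fun j => if (j < A)%N then (m j)%:R else 1 : R)).
  rewrite (big_cat_nat_idem _ (leq0n A) AN)/=; last by move=> *; rewrite mulr1.
  rewrite [X in _ = _ * X]big_nat_cond [X in _ = _ * X]big1; last first.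
    by move=> j /andP[/andP[Aj _] _]; rewrite ltnNge Aj.
  by rewrite mulr1; apply: eq_big_nat => j /andP[_ ->].
have -> : (B * M N)%:R = B%:R * \prod_(j < N) (m j)%:R :> R by rewrite natrM /Mprod natr_prod.
rewrite -big_split/=.
rewrite (eq_bigr (fun j : 'I_N => (m j)%:R * (if (j < A)%N && (j == k :> nat) then (m j)%:R else 1)))
  ; last first.
  move=> j _; rewrite /phi; case jA: (j < A)%N => /=; case jk: (j == k :> nat) => /=.
  - by rewrite sumr_const (card_Zm m_ge2).
  - rewrite mulr1 (bigD1 (coord x j))//= eqxx big1 ?addr0 ?mul1r// => c /negPf ->.
    by [].
  - by rewrite sumr_const (card_Zm m_ge2).
  - by rewrite sumr_const (card_Zm m_ge2).
rewrite big_split/= mulrC ler_wpM2r ?prodr_ge0//.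
have B1 : 1 <= B%:R :> R by rewrite ler1n (leq_trans _ (m_leB 0))// ltnW.
have [kN|kN] := ltnP k N.
  rewrite (bigD1 (Ordinal kN))//= big1 ?mulr1.
    by case: ifP => _ //; rewrite ler_nat.
  by move=> j; rewrite -val_eqE/= => /negPf ->; rewrite andbF.
rewrite big1// => j _; case: eqP; rewrite ?andbF// => jk.
by have := ltn_ord j; rewrite jk ltnNge kN.
Qed.

Lemma sum_samecyl N i u : (i <= N)%N ->
  (\sum_(t <- reps m N) (samecyl i u t)%:R) * (M i)%:R = (M N)%:R :> R.
Proof.
move=> iN.
have Fi : level i (fun t => (samecyl i t u)%:R : R).
  by move=> x y xy; rewrite (level_samecyl u (leqnn i) xy).
under eq_bigr do rewrite samecylC.
rewrite mulr_natr (sum_reps_level m_ge2 iN Fi); congr (_ *+ _).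
have := @sum_reps_decomp m R i (fun=> 1) u (fun _ _ _ => erefl).
by under eq_bigr do rewrite mulr1.
Qed.

End Kernels.

(** * Fejer means of a function carried by one cell *)

Section Atoms.
Variables (R : realType) (m : nat -> nat) (B : nat).
Hypothesis m_ge2 : forall k, (2 <= m k)%N.
Hypothesis m_leB : forall k, (m k <= B)%N.
Local Notation G := (vilenkin m).
Local Notation M := (Mprod m).
Local Notation normc := (@Normc.normc R).
Local Notation psi := (psi R).

(* Not normalized: the convolution of level-N functions is conv N divided by M N. *)
Definition conv N (h g : G -> R[i]) (x : G) : R[i] :=
  \sum_(t <- reps m N) h t * g (vsub x t).

(* Up to a constant, dominates all Fejer means of an atom of height 1 on the cell of
   level i around 0.  The bound holds on the cell itself as well, so that it also serves
   for bounded functions, with i = 0. *)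
Definition atom_bound (i : nat) (y : G) : R := fejer_majorant R i.+1 y / (M i)%:R ^+ 2.

Lemma MR_gt0 k : 0 < (M k)%:R :> R.
Proof. by rewrite ltr0n Mprod_gt0. Qed.

Lemma MR_double k : 2 * (M k)%:R <= (M k.+1)%:R :> R.
Proof. by rewrite -natrM ler_nat Mprod_double. Qed.

Lemma sum_MR A : \sum_(k < A.+1) (M k)%:R <= 2 * (M A)%:R :> R.
Proof.
elim: A => [|A IH]; first by rewrite big_ord1 ler_peMl// ?ler1n// ltW// MR_gt0.
by rewrite big_ord_recr/=; have := MR_double A; lra.
Qed.

Lemma atom_bound_ge0 i y : 0 <= atom_bound i y.
Proof. by rewrite divr_ge0 ?fejer_majorant_ge0// exprn_ge0. Qed.

Lemma fejer_majorant_atom_bound i y : fejer_majorant R i.+1 y = (M i)%:R ^+ 2 * atom_bound i y.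
Proof. by rewrite /atom_bound mulrC divfK// expf_neq0// gt_eqF// MR_gt0. Qed.

Lemma atom_bound_row i y :
  \sum_(k < i.+1) (M k)%:R * (Jset k i y)%:R <= (M i)%:R * atom_bound i y.
Proof.
rewrite -(ler_pM2l (MR_gt0 i)) mulrA -expr2 -fejer_majorant_atom_bound mulr_sumr /fejer_majorant.
rewrite [leRHS]big_ord_recr/=; apply: (@le_trans _ _ (\sum_(k < i.+1) (M k)%:R * (M i)%:R * (Jset k i y)%:R)).
  by apply: ler_sum => k _; rewrite mulrCA mulrA.
by rewrite lerDr sumr_ge0// => A _; rewrite sumr_ge0.
Qed.

Lemma atom_bound_diag i y : (Jset i i y)%:R <= atom_bound i y.
Proof.
rewrite -(ler_pM2l (MR_gt0 i)); apply: le_trans (atom_bound_row _ _).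
by rewrite big_ord_recr/= lerDr sumr_ge0.
Qed.

Lemma ex_Mprod_itv n : (0 < n)%N -> exists s, (M s <= n < M s.+1)%N.
Proof.
move=> n0; have ex : exists s, (n < M s)%N by exists n; apply: ltn_Mprod.
case: (ex_minnP ex) => -[|s] ns h; first by rewrite Mprod0 in ns; lia.
by exists s; rewrite ns andbT leqNgt; apply/negP => /h; rewrite ltnn.
Qed.

Lemma Mprod_ltn_inv i s : (M i < M s)%N -> (i < s)%N.
Proof. by apply: contraTT; rewrite -!leqNgt; apply: leq_Mprod. Qed.

(** The unnormalized convolution of the indicators of the cell of u and of the set [Jset k A]. *)
Definition Jcount N i u k A (x : G) : R :=
  \sum_(t <- reps m N) (samecyl i u t)%:R * (Jset k A (vsub x t))%:R.

(** The set constrains only coordinates below i, where all t of the cell agree with u: either every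
    t counts or none does. *)
Lemma Jcount_lo N i u k A x : (i <= N)%N -> (A <= i)%N ->
  Jcount N i u k A x * (M i)%:R <= (M N)%:R * (Jset k A (vsub x u))%:R.
Proof.
move=> iN Ai; rewrite -(sum_samecyl R m_ge2 u iN) mulrAC ler_wpM2r// mulr_suml.
apply: ler_sum => t _; case: samecylP => [ut|]; last by rewrite !mul0r.
rewrite !mul1r ler_nat; case: JsetP => // h; case: JsetP => // -[] j jA jk.
by rewrite coord_vsub ut ?(leq_trans jA)// -coord_vsub h.
Qed.

(** If some t counts, the coordinates of x - u below i vanish, except the k-th if k < i; [minn k i]
    encodes no exception otherwise. The number of such t is bounded by the size of the whole set. *)
Lemma Jcount_hi N i u k A x : (A <= N)%N -> (i <= A)%N ->
  Jcount N i u k A x * (M A)%:R <= (B * M N)%:R * (Jset (minn k i) i (vsub x u))%:R.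
Proof.
move=> AN iA.
apply: (@le_trans _ _ ((\sum_(t <- reps m N) (Jset k A (vsub x t))%:R) * (M A)%:R *
   (Jset (minn k i) i (vsub x u))%:R)); last first.
  by rewrite ler_wpM2r//; apply: Jset_measure.
rewrite [leRHS]mulrAC ler_wpM2r// mulr_suml.
apply: ler_sum => t _; case: samecylP => [ut|]; last by rewrite !mul0r mulr_ge0.
rewrite !mul1r -natrM ler_nat; case: JsetP => // h; case: JsetP => // -[] j ji jk.
rewrite coord_vsub ut// -coord_vsub h//; first exact: leq_trans iA.
by apply: contra jk => /eqP jk; apply/eqP; lia.
Qed.

(** A size estimate, without cancellation; it is good enough because n >= M_i. Two factors B come
    from the kernel majorant and one from [Jset_measure]. The 7 is 1 + 6: the terms A <= i add up to
    M_i P <= n P, and each A > i costs 3 M_A P, in total at most 6 n P, where P is the atom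
    bound. *)
Lemma atom_conv N i n u a (h : G -> R[i]) x :
  (M i <= n < M N)%N -> 0 <= a ->
  (forall t, normc (h t) <= a * (samecyl i u t)%:R) ->
  normc (conv N h (fejer_sum R n) x) <=
  (7 * B ^ 3 * M N * n)%:R * a * atom_bound i (vsub x u).
Proof.
case/andP => Mi nN a0 ha; set y := vsub x u.
have [s /andP[sn ns]] : exists s, (M s <= n < M s.+1)%N.
  by apply: ex_Mprod_itv; apply: leq_trans Mi; apply: Mprod_gt0.
have iS : (i <= s)%N by rewrite -ltnS; apply: Mprod_ltn_inv; exact: leq_ltn_trans ns.
have sN : (s < N)%N by apply: Mprod_ltn_inv; exact: leq_ltn_trans nN.
have P0 := atom_bound_ge0 i y; set P := atom_bound i y in P0 *.
apply: (@le_trans _ _ (a * (B ^ 2)%:R *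
    \sum_(A < s.+1) \sum_(k < A.+1) (M k)%:R * (M A)%:R * Jcount N i u k A x)).
  apply: le_trans (normc_sum _ _ _) _.
  apply: (@le_trans _ _ (\sum_(t <- reps m N)
      a * (B ^ 2)%:R * ((samecyl i u t)%:R * fejer_majorant R s.+1 (vsub x t)))).
    apply: ler_sum => t _; rewrite normcM [leRHS]mulrACA ler_pM ?normc_ge0//.
    exact: fejer_sum_le.
  rewrite -mulr_sumr ler_wpM2l// ?mulr_ge0//.
  rewrite /fejer_majorant; under eq_bigr do rewrite mulr_sumr.
  rewrite exchange_big/=; apply: ler_sum => A _.
  under eq_bigr do rewrite mulr_sumr.
  rewrite exchange_big/=; apply: ler_sum => k _.
  by rewrite /Jcount mulr_sumr; apply: ler_sum => t _; rewrite mulrCA.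
have Mi0 := MR_gt0 i.
have inner (A : 'I_s.+1) :
    \sum_(k < A.+1) (M k)%:R * (M A)%:R * Jcount N i u k A x <=
    (B * M N)%:R * ((if (A < i.+1)%N then (\sum_(k < A.+1) (M k)%:R * (M A)%:R * (Jset k A y)%:R) / (M i)%:R
                    else 0) + 3 * (M A)%:R * P).
  have AN : (A <= N)%N by apply: ltnW; apply: leq_trans (ltn_ord A) sN.
  have iN : (i <= N)%N by apply: leq_trans iS (ltnW sN).
  have B1 : (1 <= B)%N by apply: leq_trans (m_leB 0); apply: ltnW.
  have MA0 := MR_gt0 A.
  case: ltnP => Ai.
    rewrite mulrDr -[leLHS]addr0; apply: lerD; last first.
      by apply: mulr_ge0 => //; apply: mulr_ge0 => //; exact: mulr_ge0.
    rewrite mulr_suml mulr_sumr; apply: ler_sum => k _.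
    rewrite mulrA ler_pdivlMr// -(mulrA _ (Jcount _ _ _ _ _ _)) [leRHS]mulrCA ler_wpM2l ?mulr_ge0//.
    apply: (le_trans (Jcount_lo u k x iN Ai)).
    by rewrite ler_wpM2r// ler_nat leq_pmull.
  rewrite add0r.
  apply: (@le_trans _ _ ((B * M N)%:R * \sum_(k < A.+1) (M k)%:R * (Jset (minn k i) i y)%:R)).
    rewrite mulr_sumr; apply: ler_sum => k _.
    rewrite -mulrA [leRHS]mulrCA ler_wpM2l// mulrC; exact/Jcount_hi/ltnW.
  rewrite ler_wpM2l//.
  (* Indices k <= i form the top row of the atom bound and cost M_i P <= M_A P. For k > i the set is
     the whole cell of level i, and the sum of the M_k is at most 2 M_A. This gives the factor 3. *)
  apply: (@le_trans _ _ (\sum_(k < A.+1) ((if (k < i.+1)%N then (M k)%:R * (Jset k i y)%:R else 0)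
      + (M k)%:R * (Jset i i y)%:R))).
    apply: ler_sum => k _; have [ki|ik] := leqP k i.
      by rewrite ltnS ki lerDl mulr_ge0.
    by rewrite ltnS leqNgt ik add0r.
  rewrite big_split/= -mulr_suml -big_mkcond/= -(big_ord_widen _ (fun k => (M k)%:R * (Jset k i y)%:R))//; last exact: ltnW.
  have h1 := atom_bound_row i y; have h2 := atom_bound_diag i y.
  have h3 := sum_MR A; have h4 : (M i)%:R <= (M A)%:R :> R by rewrite ler_nat leq_Mprod// ltnW.
  have h5 : (\sum_(k < A.+1) (M k)%:R) * (Jset i i y)%:R <= 2 * (M A)%:R * P.
    by rewrite ler_pM// sumr_ge0.
  have h6 : (M i)%:R * P <= (M A)%:R * P by rewrite ler_wpM2r.
  rewrite -/P in h1; lra.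
have tot : \sum_(A < s.+1) \sum_(k < A.+1) (M k)%:R * (M A)%:R * Jcount N i u k A x
    <= (B * M N)%:R * (7 * n%:R * P).
  apply: (le_trans (ler_sum _ (fun A _ => inner A))).
  rewrite -mulr_sumr ler_wpM2l// big_split/= -big_mkcond/=.
  rewrite -(big_ord_widen _ (fun A : nat => (\sum_(k < A.+1) (M k)%:R * (M A)%:R * (Jset k A y)%:R) / (M i)%:R))//.
  rewrite -mulr_suml -/(fejer_majorant R i.+1 y) fejer_majorant_atom_bound -/P.
  rewrite -mulr_suml -mulr_sumr.
  have -> : (M i)%:R ^+ 2 * P / (M i)%:R = (M i)%:R * P by field; rewrite gt_eqF.
  have h3 := sum_MR s.
  have h1 : (M i)%:R <= n%:R :> R by rewrite ler_nat.
  have h2 : (M s)%:R <= n%:R :> R by rewrite ler_nat.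
  have -> : 7 * n%:R * P = n%:R * P + 3 * (2 * n%:R) * P by ring.
  by apply: lerD; rewrite ler_wpM2r// ler_wpM2l//; apply: le_trans h3 _; rewrite ler_wpM2l.
apply: le_trans (ler_wpM2l _ tot) _; first by rewrite mulr_ge0.
rewrite le_eqVlt; apply/orP; left; apply/eqP; rewrite !natrM ?natrX; ring.
Qed.

Lemma level_dirichlet k s : (k <= M s)%N -> level s (dirichlet R (m := m) k).
Proof.
move=> ks x y xy; apply: eq_bigr => j _.
by apply: (level_psi R m_ge2 _ xy); apply: leq_trans (ltn_ord j) ks.
Qed.

Lemma level_fejer_sum n s : (n <= M s)%N -> level s (fejer_sum R (m := m) n).
Proof.
move=> ns x y xy; apply: eq_bigr => k _; apply: level_dirichlet xy.
exact: leq_trans (ltnW (ltn_ord k)) ns.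
Qed.

Lemma agree_vsub n (x y z : G) : agree n y z -> agree n (vsub x y) (vsub x z).
Proof. by move=> yz k kn; rewrite !coord_vsub yz. Qed.

(** For n <= M_i the kernel, as a function of t, is constant on the cells of level i, hence
    orthogonal to h. *)
Lemma conv_cancel N i n (h : G -> R[i]) x : (n <= M i)%N ->
  (forall g : G -> R[i], level i g -> \sum_(t <- reps m N) h t * g t = 0) ->
  conv N h (fejer_sum R n) x = 0.
Proof.
move=> ni hg; apply: (hg (fun t => fejer_sum R n (vsub x t))) => y z yz.
by apply: (level_fejer_sum ni); apply: agree_vsub.
Qed.

End Atoms.

(** * Real inequalities: truncated sums and geometric series *)

Section Scalars.
Variable R : realType.

Lemma sum_min_doubling (z : nat -> R) n : (forall k, 0 < z k) ->
  (forall k, 2 * z k <= z k.+1) -> \sum_(k < n) Num.min (z k) (z k)^-1 <= 4.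
Proof.
move=> z0 zd.
have [->|[k ->]] : n = 0%N \/ exists k, n = k.+1 by case: n; [left|move=> k; right; exists k].
  by rewrite big_ord0.
(* Two geometric series meet where z crosses 1. Up to there the sum is at most twice its last term;
   afterwards 4 minus the last term leaves room for the tail. *)
suff : \sum_(i < k.+1) Num.min (z i) (z i)^-1 <=
    (if z k <= 1 then 2 * z k else 4 - (z k)^-1).
  move=> /le_trans; apply; case: ifP => h; first lra.
  by have : 0 < (z k)^-1; [rewrite invr_gt0|lra].
elim: k => [|k IH].
  rewrite big_ord1; have h0 := z0 0%N; case: (lerP (z 0%N) 1) => h.
    by apply: (@le_trans _ _ (z 0%N)); [rewrite ge_min lexx|lra].
  have : (z 0%N)^-1 < 1 by rewrite invf_lt1.
  by move=> h1; apply: (@le_trans _ _ (z 0%N)^-1); [rewrite ge_min lexx orbT|lra].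
rewrite big_ord_recr/=; apply: le_trans (lerD IH (lexx _)) _.
have h0 := z0 k; have h1 := z0 k.+1; have h2 := zd k.
case: (lerP (z k.+1) 1) => h.
  rewrite ifT; last by lra.
  have : Num.min (z k.+1) (z k.+1)^-1 <= z k.+1 by rewrite ge_min lexx.
  by lra.
have mi : Num.min (z k.+1) (z k.+1)^-1 <= (z k.+1)^-1 by rewrite ge_min lexx orbT.
have i1 : (z k.+1)^-1 < 1 by rewrite invf_lt1.
case: ifP => h3; first lra.
suff : 2 * (z k.+1)^-1 <= (z k)^-1 by lra.
rewrite -[2]invrK -invfM lef_pV2 ?posrE ?mulr_gt0//; lra.
Qed.

Lemma sum_geom34 n : \sum_(d < n) (3 / 4) ^+ d <= 4 :> R.
Proof.
suff -> : \sum_(d < n) (3 / 4) ^+ d = 4 - 4 * (3 / 4) ^+ n :> R.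
  by have : 0 <= (3 / 4) ^+ n :> R; [rewrite exprn_ge0//; lra|lra].
by elim: n => [|n IH]; rewrite ?big_ord0 ?big_ord_recr/= ?IH ?exprS; field.
Qed.

Lemma min_sum I (r : seq I) (P : pred I) (F : I -> R) (e : R) : 0 <= e ->
  (forall i, 0 <= F i) -> Num.min (\sum_(i <- r | P i) F i) e <= \sum_(i <- r | P i) Num.min (F i) e.
Proof.
move=> e0 F0; set S := (X in Num.min X e); set T := (X in _ <= X).
suff [] : 0 <= S /\ Num.min S e <= T by [].
rewrite /S /T; elim/big_rec2: _ => [|i x y _ [y0 IH]]; first by rewrite ge_min lexx.
have Fi := F0 i; split; first exact: addr_ge0.
move: IH; case: (leP (F i) e); case: (leP y e); case: (leP (F i + y) e) => *; lra.
Qed.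

(** A geometric sum is at most twice its last term, here a 2^k with 4^k < y. *)
Lemma sum_pow2_sqrt n (y : R) : 0 <= y ->
  \sum_(k < n) 2 ^+ k * (4 ^+ k < y)%R%:R <= 2 * Num.sqrt y.
Proof.
move=> y0; have s0 := sqrtr_ge0 y.
elim: n => [|n IH]; first by rewrite big_ord0 mulr_ge0.
have s4 : 4 ^+ n = (2 ^+ n) ^+ 2 :> R by rewrite -exprM mulnC exprM; congr (_ ^+ _); lra.
case: (ltrP (4 ^+ n) y) => h; last first.
  by rewrite big_ord_recr/= ltNge h mulr0 addr0.
have h2 : 2 ^+ n <= Num.sqrt y.
  by rewrite -(@ger0_norm _ (2 ^+ n)) ?exprn_ge0// -sqrtr_sqr ler_wsqrtr// -s4 ltW.
apply: (@le_trans _ _ (\sum_(k < n.+1) 2 ^+ k)).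
  by apply: ler_sum => k _; rewrite -[leRHS]mulr1 ler_wpM2l ?exprn_ge0// lern1 leq_b1.
have -> : \sum_(k < n.+1) 2 ^+ k = 2 * 2 ^+ n - 1 :> R.
  elim: n {IH s4 h h2} => [|n IH]; first by rewrite big_ord1 !expr0; lra.
  by rewrite big_ord_recr/= IH exprS; lra.
by lra.
Qed.

Variable m : nat -> nat.
Hypothesis m_ge2 : forall k, (2 <= m k)%N.
Local Notation M := (Mprod m).

Lemma Mprod_pow2 k d : (2 ^ d * M k <= M (d + k))%N.
Proof.
elim: d => [|d IH]; first by rewrite mul1n.
rewrite expnS -mulnA addSn; apply: leq_trans (Mprod_double m_ge2 _).
by rewrite leq_mul2l IH orbT.
Qed.

(* Without the truncation at l, the corresponding sum of square roots is of order i / M i: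
   the maximal Fejer mean of an atom is only uniformly in weak-L_(1/2). *)
Lemma sum_min_layers i (s l : R) : 0 < s -> 0 < l ->
  \sum_(A < i.+1) \sum_(k < A.+1)
     Num.min (s ^+ 2 * l * ((M k)%:R * (M A)%:R) / (M i)%:R ^+ 2) l / (M A)%:R
  <= 16 * s * l / (M i)%:R.
Proof.
move=> s0 l0.
have M0 k : 0 < (M k)%:R :> R by apply: MR_gt0.
pose c : R := s * l / (M i)%:R.
have c0 : 0 < c by rewrite /c divr_gt0 ?mulr_gt0.
(* With d = A - k, M_k <= 2^(-d) M_A, so the two arguments of the minimum are at most c (3/4)^d
   times w and 1/w. This needs (3/4)^2 = 9/16 >= 1/2. For fixed d, w at least doubles with A, so the
   sum over A costs 4; the series in d costs another 4, whence 16. *)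
pose w d A : R := (M A)%:R * s / (M i)%:R * (3 / 4) ^+ d.
have p0 d : 0 < (3 / 4) ^+ d :> R by rewrite exprn_gt0//; lra.
have w0 d A : 0 < w d A by rewrite !mulr_gt0 ?invr_gt0.
pose g d A : R := (3 / 4) ^+ d * (c * Num.min (w d A) (w d A)^-1).
have g0 d A : 0 <= g d A.
  apply: mulr_ge0; first exact: ltW.
  by apply: mulr_ge0; rewrite ?le_min ?invr_ge0 ltW ?w0.
have key (A : 'I_i.+1) (k : 'I_A.+1) :
   Num.min (s ^+ 2 * l * ((M k)%:R * (M A)%:R) / (M i)%:R ^+ 2) l / (M A)%:R <= g (A - k)%N A.
  set d := (A - k)%N.
  have kA : (2 ^ d * M k <= M A)%N.
    by apply: leq_trans (Mprod_pow2 k d) _; rewrite /d subnK// -ltnS.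
  have cd0 : 0 <= (3 / 4) ^+ d * c by apply: mulr_ge0; apply: ltW.
  rewrite /g [leRHS]mulrA [leRHS](minr_pMr _ _ cd0) le_min; apply/andP; split.
    apply: (@le_trans _ _ (s ^+ 2 * l * ((M k)%:R * (M A)%:R) / (M i)%:R ^+ 2 / (M A)%:R)).
      by rewrite ler_wpM2r ?invr_ge0// ge_min lexx.
    have -> : s ^+ 2 * l * ((M k)%:R * (M A)%:R) / (M i)%:R ^+ 2 / (M A)%:R =
        c * (s / (M i)%:R) * (M k)%:R.
      by rewrite /c; field; rewrite !gt_eqF.
    have -> : (3 / 4) ^+ d * c * w d A = c * (s / (M i)%:R) * ((9 / 16) ^+ d * (M A)%:R).
      have -> : (9 / 16) ^+ d = (3 / 4) ^+ d * (3 / 4) ^+ d :> R.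
        by rewrite -exprMn; congr (_ ^+ _); lra.
      by rewrite /w; ring.
    apply: ler_wpM2l; first by apply: mulr_ge0; [exact: ltW|apply: divr_ge0 => //; exact: ltW].
    have kA' : 2 ^+ d * (M k)%:R <= (M A)%:R :> R by rewrite -natrX -natrM ler_nat.
    rewrite -(@ler_pM2l _ (2 ^+ d)) ?exprn_gt0//; apply: (le_trans kA').
    rewrite mulrA -exprMn ler_peMl// exprn_ege1//; lra.
  have -> : (3 / 4) ^+ d * c * (w d A)^-1 = l / (M A)%:R.
    by rewrite /w /c; field; rewrite !gt_eqF ?exprn_gt0//; lra.
  by rewrite ler_wpM2r ?invr_ge0// ge_min lexx orbT.
apply: (@le_trans _ _ (\sum_(A < i.+1) \sum_(d < i.+1) g d A)).
  apply: ler_sum => A _; apply: le_trans (ler_sum _ (fun k _ => key A k)) _.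
  rewrite (reindex_inj rev_ord_inj)/=.
  under eq_bigr => k _ do rewrite subSS (subKn (leq_ord k)).
  rewrite (big_ord_widen _ (fun d => g d A) (ltn_ord A)) big_mkcond/=.
  by apply: ler_sum => d _; case: ifP.
rewrite exchange_big/=.
apply: (@le_trans _ _ (\sum_(d < i.+1) (3 / 4) ^+ d * (c * 4))).
  apply: ler_sum => d _; rewrite -mulr_sumr -mulr_sumr.
  apply: ler_wpM2l; first exact: ltW; apply: ler_wpM2l; first exact: ltW.
  apply: sum_min_doubling => // k; rewrite /w -!mulrA mulrA.
  apply: ler_wpM2r; last exact: MR_double.
  by apply: mulr_ge0; [exact: ltW|apply: mulr_ge0; [rewrite invr_ge0|exact: ltW]].
rewrite -mulr_suml; apply: le_trans (ler_wpM2r _ (sum_geom34 _)) _; first by rewrite mulr_ge0// ltW.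
rewrite /c le_eqVlt; apply/orP; left; apply/eqP; ring.
Qed.

End Scalars.

(** * Predictable stopping and the decomposition into atoms *)

Section Stopping.
Variables (R : realType) (m : nat -> nat) (B : nat).
Hypothesis m_ge2 : forall k, (2 <= m k)%N.
Hypothesis m_leB : forall k, (m k <= B)%N.
Local Notation G := (vilenkin m).
Local Notation M := (Mprod m).
Local Notation normc := (@Normc.normc R).

(** Running through all values of a coordinate amounts to running through all its shifts, and each
    shift preserves the sum. *)
Lemma sum_reps_upd (V : nmodType) N n (F : G -> V) : level N F -> (n < N)%N ->
  \sum_(t <- reps m N) \sum_(c : 'Z_(m n)) F (upd t c) = (\sum_(t <- reps m N) F t) *+ m n.
Proof.
move=> FN nN; rewrite -[in RHS](card_Zm m_ge2 n) -sumr_const.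
under [RHS]eq_bigr => c _ do rewrite -(sum_reps_shift c FN).
rewrite [RHS]exchange_big/=; apply: eq_bigr => t _.
by rewrite (reindex_inj (addrI (coord t n))).
Qed.

Variable f : nat -> G -> R[i].
Hypothesis f_level : forall n, level n (f n).
Hypothesis f_avg : forall n x, \sum_(c : 'Z_(m n)) f n.+1 (upd x c) = f n x *+ m n.

(** A martingale difference has average 0 over each family of siblings, on which W is constant. *)
Lemma mart_orth N n (W : G -> R[i]) : (n < N)%N -> level n W ->
  \sum_(t <- reps m N) (f n.+1 t - f n t) * W t = 0.
Proof.
move=> nN Wn.
under eq_bigr do rewrite mulrBl; rewrite sumrB; apply/eqP; rewrite subr_eq0; apply/eqP.
have FN : level N (fun t => f n.+1 t * W t).
  move=> x y xy; rewrite (f_level (agreeW nN xy)).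
  by rewrite (Wn x y)//; apply: agreeW xy; exact: ltnW.
have mn : (m n)%:R != 0 :> R[i] by rewrite pnatr_eq0 -lt0n ltnW.
apply: (mulIf mn); rewrite !mulr_natr -(sum_reps_upd FN nN) -sumrMnl.
apply: eq_bigr => t _; rewrite -mulrnAl -f_avg mulr_suml; apply: eq_bigr => c _.
by congr (_ * _); apply: Wn; exact: agree_upd.
Qed.

(* The maximum over all siblings makes this depend on the coordinates below n only,
   which is what allows stopping before a jump. *)
Definition pmax n (x : G) : R :=
  \big[Num.max/0]_(c : 'Z_(m n)) normc (f n.+1 (upd x c)).

(** It starts from 0 and ignores [f 0], so bounds on stopped martingales assume |f 0| <= t
    separately. *)
Fixpoint pmaxn n (x : G) : R :=
  if n is k.+1 then Num.max (pmaxn k x) (pmax k x) else 0.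
Arguments pmaxn : simpl never.

Definition fmax n (x : G) : R := \big[Num.max/0]_(i < n.+1) normc (f i x).

Lemma level_pmax n : level n (pmax n).
Proof.
move=> x y xy; rewrite /pmax; apply: eq_bigr => c _.
by rewrite (f_level (agree_updS c xy)).
Qed.

Lemma level_pmaxn n k : (n <= k.+1)%N -> level k (pmaxn n).
Proof.
move=> nk x y xy; elim: n nk => // n IH nk; rewrite /pmaxn -/pmaxn IH ?(ltnW nk)//.
by rewrite (level_pmax (agreeW _ xy)).
Qed.

Lemma pmaxnS n x : pmaxn n.+1 x = Num.max (pmaxn n x) (pmax n x).
Proof. by []. Qed.

Lemma pmaxn_le i j x : (i <= j)%N -> pmaxn i x <= pmaxn j x.
Proof.
elim: j => [|j IH]; first by rewrite leqn0 => /eqP ->.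
rewrite leq_eqVlt => /predU1P[->//|/IH h].
by rewrite pmaxnS le_max h.
Qed.

Lemma normc_le_pmax n x : normc (f n.+1 x) <= pmax n x.
Proof.
rewrite (f_level (agree_sym (agree_upd_coord x))) /pmax.
by apply: (le_bigmax _ (fun c => normc (f n.+1 (upd x c)))).
Qed.

(** A martingale transform: the weight of the i-th increment has level i, hence is predictable. *)
Definition stop (t : R) n (x : G) : R[i] :=
  f 0 x + \sum_(i < n) (f i.+1 x - f i x) * (pmaxn i.+1 x <= t)%R%:R.

Lemma stop_all t n x : pmaxn n x <= t -> stop t n x = f n x.
Proof.
elim: n => [|n IH] h; first by rewrite /stop big_ord0 addr0.
rewrite /stop big_ord_recr/= addrA -/(stop t n x) IH; last first.
  by apply: le_trans h; apply: pmaxn_le.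
by rewrite h mulr1 addrCA subrr addr0.
Qed.

(** Either nothing has been stopped yet and the value f_n lies below the predictable maximum, or the
    last increment is dropped. *)
Lemma stop_le t n x : normc (f 0 x) <= t -> normc (stop t n x) <= t.
Proof.
move=> f0; elim: n => [|n IH]; first by rewrite /stop big_ord0 addr0.
have [h|h] := lerP (pmaxn n.+1 x) t.
  rewrite stop_all//; apply: le_trans (normc_le_pmax _ _) _.
  by apply: le_trans h; rewrite pmaxnS le_max lexx orbT.
by rewrite /stop big_ord_recr/= addrA -/(stop t n x) (leNgt (pmaxn _ _)) h mulr0 addr0.
Qed.

(** The stopping time at height t equals i: from then on the stopped martingale stays at f_i. *)
Definition first_above t i (x : G) : bool := (pmaxn i x <= t) && (t < pmax i x).

Lemma level_first t i : level i (first_above t i).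
Proof.
move=> x y xy; rewrite /first_above (level_pmax xy) (_ : pmaxn i x = pmaxn i y)//.
exact: (level_pmaxn (leqnSn i)).
Qed.

Lemma sum_first (A : nzRingType) t n x : 0 <= t ->
  \sum_(i < n) (first_above t i x)%:R = (t < pmaxn n x)%R%:R :> A.
Proof.
move=> t0; elim: n => [|n IH]; first by rewrite big_ord0 ltNge t0.
rewrite big_ord_recr/= IH pmaxnS /first_above lt_max leNgt.
by case: (t < pmaxn n x) => /=; rewrite ?addr0 ?add0r.
Qed.

(* Each cell stopped at level i has a child on which |f| exceeds t. *)
Lemma sum_pmaxn_fmax t N : 0 <= t ->
  \sum_(x <- reps m N) (t < pmaxn N x)%R%:R <=
  B%:R * \sum_(x <- reps m N) (t < fmax N x)%R%:R :> R.
Proof.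
move=> t0; under eq_bigr do rewrite -(sum_first _ _ _ t0).
rewrite exchange_big/=.
have step (i : 'I_N) : \sum_(x <- reps m N) (first_above t i x)%:R <=
    B%:R * \sum_(x <- reps m N) (first_above t i x)%:R * (t < fmax N x)%R%:R :> R.
  pose F x : R := (first_above t i x)%:R * (t < normc (f i.+1 x))%R%:R.
  have FN : level N F.
    move=> x y xy; rewrite /F (f_level (agreeW _ xy))//.
    by rewrite (level_first t (agreeW (ltnW (ltn_ord i)) xy)).
  apply: (@le_trans _ _ (\sum_(x <- reps m N) \sum_(c : 'Z_(m i)) F (upd x c))).
    apply: ler_sum => x _; rewrite /F.
    under eq_bigr => c _ do rewrite (level_first t (agree_upd x c)).
    case fx : (first_above t i x); last by rewrite sumr_ge0// => c _; rewrite mul0r.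
    case/andP: fx => _; rewrite /pmax => tm.
    have [c _ ec] : exists2 c : 'Z_(m i), true & t < normc (f i.+1 (upd x c)).
      apply/exists_inP; apply: contraLR tm; rewrite negb_exists_in => /forall_inP h.
      by rewrite -leNgt; apply/bigmax_leP; split => // c _; rewrite leNgt h.
    by rewrite (bigD1 c)//= ec mulr1 lerDl sumr_ge0// => d _; rewrite mulr_ge0.
  rewrite sum_reps_upd// -[leLHS]mulr_natl.
  apply: ler_pM => //; first by rewrite sumr_ge0// => x _; rewrite mulr_ge0.
    by rewrite ler_nat.
  apply: ler_sum => x _; rewrite ler_wpM2l// ler_nat.
  have : normc (f i.+1 x) <= fmax N x.
    have iN : (i.+1 < N.+1)%N by rewrite ltnS.
    exact: (le_bigmax _ (fun i : 'I_N.+1 => normc (f i x)) (Ordinal iN)).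
  by move=> h; case: ltP => // /lt_le_trans /(_ h) ->.
apply: le_trans (ler_sum _ (fun i _ => step i)) _.
rewrite -mulr_sumr ler_wpM2l// exchange_big/=; apply: ler_sum => x _.
by rewrite -mulr_suml sum_first// ler_piMl// lern1 leq_b1.
Qed.

Section Piece.
Variables (N : nat) (t t' : R).
Hypothesis t0 : 0 <= t.
Hypothesis tt' : t <= t'.

Definition piece (x : G) : R[i] := stop t' N x - stop t N x.

Definition atom i (u x : G) : R[i] :=
  (first_above t i u)%:R * ((samecyl i u x)%:R * piece x).

Lemma pieceE x : piece x = \sum_(n < N) (f n.+1 x - f n x) * (t < pmaxn n.+1 x <= t')%R%:R.
Proof.
rewrite /piece /stop opprD addrACA subrr add0r -sumrB; apply: eq_bigr => n _.
rewrite -mulrBr; congr (_ * _); case: (lerP (pmaxn n.+1 x) t) => h /=.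
  by rewrite (le_trans h tt') subrr.
by rewrite subr0.
Qed.

(** The piece vanishes where the predictable maximum never exceeds t; elsewhere exactly one stopping
    cell contains x. *)
Lemma piece_sum_atoms x : piece x = \sum_(i < N) \sum_(u <- reps m i) atom i u x.
Proof.
transitivity ((t < pmaxn N x)%R%:R * piece x).
  case: ltrP => h; first by rewrite mul1r.
  rewrite mul0r pieceE big1// => n _; rewrite ltNge (le_trans _ h) ?mulr0//.
  exact: pmaxn_le.
rewrite -(sum_first _ _ _ t0) mulr_suml; apply: eq_bigr => i _.
have Fi : level i (fun u => (first_above t i u)%:R : R[i]) by move=> u v /level_first ->.
rewrite -(sum_reps_decomp x Fi) mulr_suml; apply: eq_bigr => u _.
by rewrite /atom mulrA [X in X * _]mulrC.
Qed.

Lemma atom_le i u x : normc (f 0 x) <= t ->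
  normc (atom i u x) <= 2 * t' * (first_above t i u)%:R * (samecyl i u x)%:R.
Proof.
move=> ft; rewrite /atom !normcM !normc_nat.
have -> : 2 * t' * (first_above t i u)%:R * (samecyl i u x)%:R =
  (first_above t i u)%:R * ((samecyl i u x)%:R * (2 * t')) by ring.
rewrite ler_wpM2l// ler_wpM2l//; apply: le_trans (normcB _ _) _.
have := stop_le N ft; have := stop_le N (le_trans ft tt'); have := tt'; lra.
Qed.

(** Increments before i vanish on a stopping cell, where the predictable maximum is still at most t.
    A later increment n meets only factors of level n: the cell, the predictable weight and g. *)
Lemma atom_orth i u g : level i g -> \sum_(x <- reps m N) atom i u x * g x = 0.
Proof.
move=> gi; under eq_bigr do rewrite /atom pieceE -!mulrA mulr_suml !mulr_sumr.
rewrite exchange_big/= big1// => n _.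
have [ni|ni] := ltnP n i.
  rewrite big1// => x _; case fu : first_above; last by rewrite mul0r.
  case: samecylP => ux; last by rewrite !mul0r mulr0.
  rewrite (_ : (t < pmaxn n.+1 x) = false) ?mulr0 ?mul0r ?mulr0//.
  case/andP: fu => fu _; apply/negbTE; rewrite -leNgt; apply: le_trans fu.
  have -> : pmaxn i u = pmaxn i x by exact: (level_pmaxn (leqnSn i)).
  exact: pmaxn_le.
rewrite -[RHS](@mart_orth N n (fun x => (first_above t i u)%:R * ((samecyl i u x)%:R *
   ((t < pmaxn n.+1 x <= t')%R%:R * g x))))//.
  by apply: eq_bigr => x _; ring.
move=> x y xy; congr (_ * (_ * (_ * _))).
- by rewrite samecylC (level_samecyl _ ni xy) samecylC.
- by rewrite (level_pmaxn (leqnn _) xy).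
- exact/gi/(agreeW ni).
Qed.

End Piece.
End Stopping.

(** * Weak type estimate for the maximal Fejer means at a finite level *)

Section WeakType.
Variables (R : realType) (m : nat -> nat) (B : nat).
Hypothesis m_ge2 : forall k, (2 <= m k)%N.
Hypothesis m_leB : forall k, (m k <= B)%N.
Local Notation G := (vilenkin m).
Local Notation M := (Mprod m).
Local Notation normc := (@Normc.normc R).

Lemma convD N (h1 h2 g : G -> R[i]) x :
  conv N (fun t => h1 t + h2 t) g x = conv N h1 g x + conv N h2 g x.
Proof. by rewrite /conv -big_split/=; apply: eq_bigr => t _; rewrite mulrDl. Qed.

Lemma conv_sum N I (s : seq I) (h : I -> G -> R[i]) g x :
  conv N (fun t => \sum_(i <- s) h i t) g x = \sum_(i <- s) conv N (h i) g x.
Proof. by rewrite /conv exchange_big/=; apply: eq_bigr => t _; rewrite mulr_suml. Qed.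

Lemma eq_conv N (h1 h2 g : G -> R[i]) x :
  {in reps m N, h1 =1 h2} -> conv N h1 g x = conv N h2 g x.
Proof. by move=> h; apply: eq_big_seq => t /h ->. Qed.

Lemma seq_pow4_bound (F : G -> R) (s : seq G) (e : R) : 0 < e ->
  exists K, {in s, forall t, F t <= 4 ^+ K * e}.
Proof.
move=> e0; elim: s => [|a s [K HK]]; first by exists 0%N.
pose y := Num.max 0 (F a / e).
have y0 : 0 <= y by rewrite le_max lexx.
have := archi_boundP y0; set b := Num.Def.archi_bound y => yb.
exists (maxn K b) => t; rewrite inE => /predU1P[->|/HK h].
  rewrite -ler_pdivrMr//; apply: (@le_trans _ _ b%:R).
    by apply: le_trans (ltW yb); rewrite le_max lexx orbT.
  rewrite -natrX ler_nat; apply: leq_trans (ltnW (ltn_expl b (isT : 1 < 4)%N)) _.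
  by rewrite leq_exp2l// leq_maxr.
apply: (le_trans h); rewrite (ler_wpM2r (ltW e0))// -!natrX ler_nat.
by rewrite leq_exp2l// leq_maxl.
Qed.

Variable f : nat -> G -> R[i].
Hypothesis f_level : forall n, level n (f n).
Hypothesis f_avg : forall n x, \sum_(c : 'Z_(m n)) f n.+1 (upd x c) = f n x *+ m n.

Variables (N : nat) (l : R).
Hypothesis l0 : 0 < l.

(** The factors n and M_N undo the missing normalizations of [fejer_sum] and [conv]. *)
Definition fejer_exceeds (x : G) : bool :=
  [exists n : 'I_(M N), (0 < n)%N &&
     (l * n%:R * (M N)%:R < normc (conv N (f N) (fejer_sum R n) x))].

(** Twice the constant 7 B^3 of [atom_conv]: a function bounded by e then has Fejer means at most
    l/2. *)
Let e : R := l / (14 * B ^ 3)%:R.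

Let B_gt0 : (0 < B)%N.
Proof. by apply: leq_trans (m_leB 0); apply: ltnW. Qed.

Let C0 : 0 < (14 * B ^ 3)%:R :> R.
Proof. by rewrite ltr0n muln_gt0 expn_gt0 B_gt0. Qed.

Let e0 : 0 < e. Proof. by rewrite divr_gt0. Qed.

Let lE : l = (14 * B ^ 3)%:R * e.
Proof. by rewrite /e mulrC divfK// gt_eqF. Qed.

Let tk k : R := 4 ^+ k * e.

Let tk_gt0 k : 0 < tk k. Proof. by rewrite mulr_gt0// exprn_gt0. Qed.

Let tkS k : tk k.+1 = 4 * tk k. Proof. by rewrite /tk exprS mulrA. Qed.

Let tk_le k : tk k <= tk k.+1.
Proof. by rewrite tkS; have := tk_gt0 k; lra. Qed.

Let tk_ge k : e <= tk k.
Proof. by rewrite /tk (ler_peMl (ltW e0))// exprn_ege1//; lra. Qed.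

(** The atom bound at height 4^(k+1) l with each of its terms truncated separately. The power of 4
    is written as a square to match the parameter s of [sum_min_layers]. *)
Definition layer k i (x u : G) : R :=
  \sum_(A < i.+1) \sum_(a < A.+1)
     Num.min ((2 ^+ k.+1) ^+ 2 * l * ((M a)%:R * (M A)%:R) / (M i)%:R ^+ 2) l
        * (Jset a A (vsub x u))%:R.

Lemma atom_bound_min k i x u :
  Num.min (4 ^+ k.+1 * l * atom_bound R i (vsub x u)) (l / 2) <= layer k i x u.
Proof.
have l2 : 0 <= l / 2 by rewrite divr_ge0// ltW.
rewrite /atom_bound /fejer_majorant mulr_suml mulr_sumr.
have ge0 (a A : nat) : 0 <= 4 ^+ k.+1 * l * ((M a)%:R * (M A)%:R * (Jset a A (vsub x u))%:R / (M i)%:R ^+ 2).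
  by rewrite mulr_ge0// ?mulr_ge0 ?exprn_ge0 ?invr_ge0 ?exprn_ge0// ltW.
apply: le_trans (min_sum _ _ l2 _) _.
  by move=> A; rewrite mulr_suml mulr_sumr sumr_ge0.
apply: ler_sum => A _; rewrite mulr_suml mulr_sumr.
apply: le_trans (min_sum _ _ l2 _) _; first by move=> a; exact: ge0.
apply: ler_sum => a _; case: Jset; last by rewrite !mulr0 mul0r mulr0 ge_min lexx.
have -> : (2 ^+ k.+1) ^+ 2 = 4 ^+ k.+1 :> R by rewrite -exprM mulnC exprM; congr (_ ^+ _); lra.
rewrite !mulr1 mulrA le_min !ge_min lexx/=; apply/orP; right.
by rewrite ler_pdivrMr// ler_peMr ?ltW//; lra.
Qed.

Lemma fejer_exceeds_layers : normc (f 0 (vzero m)) <= e -> exists K, forall x,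
  (fejer_exceeds x)%:R * (l / 2) <= \sum_(k < K) \sum_(i < N) \sum_(u <- reps m i)
      (first_above f (tk k) i u)%:R * layer k i x u.
Proof.
move=> f0.
have f0e y : normc (f 0 y) <= e by rewrite (@f_level 0 y (vzero m))// => k; rewrite ltn0.
(* At level N there are finitely many cells, so above the K-th height nothing is stopped and the
   decomposition is finite. *)
have [K HK] := seq_pow4_bound (pmaxn f N) (reps m N) e0.
have min0 k i x u : 0 <= layer k i x u.
  rewrite !sumr_ge0// => A _; rewrite sumr_ge0// => a _; rewrite mulr_ge0// le_min (ltW l0) andbT.
  by rewrite ?mulr_ge0 ?exprn_ge0 ?invr_ge0 ?exprn_ge0// ltW.
exists K => x; case: (boolP (fejer_exceeds x)) => [|_]; last first.
  rewrite mul0r !sumr_ge0// => k _; rewrite sumr_ge0// => i _.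
  by rewrite sumr_ge0// => u _; rewrite mulr_ge0.
case/existsP => n /andP[n0 nl]; rewrite mul1r.
pose h k i u := atom f N (tk k) (tk k.+1) i u.
have dec : {in reps m N, forall t, f N t = stop f (tk 0) N t +
     \sum_(k < K) \sum_(i < N) \sum_(u <- reps m i) h k i u t}.
  move=> t /HK tK; under eq_bigr => k _ do
    rewrite -(piece_sum_atoms f_level N (ltW (tk_gt0 k)) (tk_le k)) /piece.
  rewrite -(big_mkord xpredT (fun k => stop f (tk k.+1) N t - stop f (tk k) N t)).
  by rewrite telescope_sumr// addrCA subrr addr0 stop_all.
rewrite (eq_conv _ _ dec) convD in nl.
have nR : 0 < n%:R :> R by rewrite ltr0n.
have MN0 := MR_gt0 R m_ge2 N.
(* The bounded part is treated as an atom on the whole group: i = 0, where the atom bound is 1. *)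
have low : normc (conv N (stop f (tk 0) N) (fejer_sum R n) x) <= l / 2 * n%:R * (M N)%:R.
  apply: le_trans (atom_conv m_ge2 m_leB (i:=0) (u:=vzero m) (a:=e) _ _ _ _) _.
  - by rewrite Mprod0 n0 ltn_ord.
  - exact: ltW.
  - move=> t; rewrite (_ : samecyl 0 _ _ = true) ?mulr1; last by apply/samecylP => j; rewrite ltn0.
    by apply: le_trans (stop_le f_level N _) _; rewrite /tk expr0 mul1r.
  - rewrite (_ : atom_bound R 0 _ = 1).
      rewrite mulr1 lE natrM [(7 * _ * _)%:R]natrM !natrM le_eqVlt; apply/orP; left; apply/eqP.
      by field.
    rewrite /atom_bound /fejer_majorant !big_ord1 Mprod0 expr1n !mul1r divr1.
    by rewrite (_ : Jset 0 0 _ = true)//; apply/JsetP => j; rewrite ltn0.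
(* Means of order n <= M_i vanish by cancellation. For larger n the atom has size 2 * 4^(k+1) e, and
   7 B^3 times this is 4^(k+1) l. *)
have high k i u : normc (conv N (h k i u) (fejer_sum R n) x) <=
    n%:R * (M N)%:R * ((first_above f (tk k) i u)%:R * (4 ^+ k.+1 * l * atom_bound R i (vsub x u))).
  have [ni|ni] := leqP n (M i).
    rewrite (conv_cancel m_ge2 x ni); last first.
      by move=> g gi; apply: atom_orth.
    have hl := ltW l0.
    by rewrite Normc.normc0 !mulr_ge0// ?exprn_ge0 ?fejer_majorant_ge0.
  apply: le_trans (atom_conv m_ge2 m_leB (i:=i) (u:=u) (a:=2 * tk k.+1 * (first_above f (tk k) i u)%:R) _ _ _ _) _.
  - by rewrite (ltnW ni) ltn_ord.
  - by rewrite !mulr_ge0// ltW.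
  - by move=> t; apply: atom_le => //; apply: le_trans (f0e _) (tk_ge _).
  - rewrite lE /tk !natrM le_eqVlt; apply/orP; left; apply/eqP; ring.
have tot : l / 2 < \sum_(k < K) \sum_(i < N) \sum_(u <- reps m i)
     (first_above f (tk k) i u)%:R * (4 ^+ k.+1 * l * atom_bound R i (vsub x u)).
  rewrite -(ltr_pM2l (mulr_gt0 nR MN0)).
  apply: (@lt_le_trans _ _ (normc (conv N (fun t => \sum_(k < K) \sum_(i < N) \sum_(u <- reps m i) h k i u t) (fejer_sum R n) x))).
    by have := normcD (conv N (stop f (tk 0) N) (fejer_sum R n) x)
      (conv N (fun t => \sum_(k < K) \sum_(i < N) \sum_(u <- reps m i) h k i u t) (fejer_sum R n) x);
      lra.
  rewrite conv_sum; apply: le_trans (normc_sum _ _ _) _; rewrite mulr_sumr; apply: ler_sum => k _.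
  rewrite conv_sum; apply: le_trans (normc_sum _ _ _) _; rewrite mulr_sumr; apply: ler_sum => i _.
  rewrite conv_sum; apply: le_trans (normc_sum _ _ _) _; rewrite mulr_sumr; apply: ler_sum => u _.
  exact: high.
have l2 : 0 <= l / 2 by rewrite divr_ge0// ltW.
have ge0 k i u : 0 <= (first_above f (tk k) i u)%:R * (4 ^+ k.+1 * l * atom_bound R i (vsub x u)).
  have hl := ltW l0.
  by rewrite !mulr_ge0// ?exprn_ge0 ?fejer_majorant_ge0.
(* The total exceeds l/2, so truncating it there gives exactly l/2; the truncation is then moved
   inside the three sums by subadditivity. *)
rewrite -(min_idPr (ltW tot)).
apply: le_trans (min_sum _ _ l2 _) _.
  by move=> k; rewrite sumr_ge0// => i _; rewrite sumr_ge0.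
apply: ler_sum => k _; apply: le_trans (min_sum _ _ l2 _) _.
  by move=> i; rewrite sumr_ge0.
apply: ler_sum => i _; apply: le_trans (min_sum _ _ l2 _) _.
  by move=> u.
apply: ler_sum => u _; case: first_above; last by rewrite !mul0r ge_min lexx.
by rewrite !mul1r; apply: atom_bound_min.
Qed.

(** The growth in k is 2^k, not the 4^k of the height: this is the gain from the truncation. *)
Lemma sum_layer k i u : (i <= N)%N ->
  \sum_(x <- reps m N) layer k i x u <= 32 * B%:R * l * 2 ^+ k * ((M N)%:R / (M i)%:R).
Proof.
move=> iN.
apply: (@le_trans _ _ ((B * M N)%:R * (16 * 2 ^+ k.+1 * l / (M i)%:R))); last first.
  by rewrite le_eqVlt; apply/orP; left; apply/eqP; rewrite natrM exprS; ring.
apply: le_trans (ler_wpM2l _ (sum_min_layers m_ge2 i _ l0)); last 2 first.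
- by [].
- by rewrite exprn_gt0.
rewrite /layer exchange_big/= mulr_sumr; apply: ler_sum => A _.
rewrite exchange_big/= mulr_sumr; apply: ler_sum => a _.
rewrite -mulr_sumr [leRHS]mulrCA; apply: ler_wpM2l.
  rewrite le_min (ltW l0) andbT.
  by rewrite ?mulr_ge0 ?exprn_ge0 ?invr_ge0 ?exprn_ge0// ltW.
rewrite ler_pdivlMr ?MR_gt0//.
have AN : (A <= N)%N by rewrite -ltnS; apply: leq_trans (ltn_ord A) _.
apply: le_trans (Jset_measure R m_ge2 m_leB a u AN); rewrite ler_wpM2r//.
(* The sets [Jset] are invariant under negation, which exchanges the roles of x and u. *)
apply: ler_sum => t _; rewrite ler_nat; case: JsetP => // h; case: JsetP => // -[] j jA ja.
by have /eqP := h j jA ja; rewrite !coord_vsub subr_eq0 => /eqP ->; rewrite subrr.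
Qed.

(** The constant collects 32 B from [sum_layer], B from [sum_pmaxn_fmax], 2 from [sum_pow2_sqrt],
    and 2 from dividing by l/2. *)
Theorem weak_type_fejer :
  \sum_(x <- reps m N) (fejer_exceeds x)%:R <=
  (128 * B ^ 2)%:R * \sum_(x <- reps m N) Num.sqrt (fmax f N x / e).
Proof.
have B1 : 1 <= B%:R :> R by rewrite ler1n.
(* If the constant f_0 already exceeds e, every square root on the right is at least 1 and the
   estimate is trivial. *)
have [f0|f0] := lerP (normc (f 0 (vzero m))) e; last first.
  apply: (@le_trans _ _ (\sum_(x <- reps m N) Num.sqrt (fmax f N x / e))); last first.
    by rewrite ler_peMl ?sumr_ge0// ler1n muln_gt0 expn_gt0 B_gt0.
  apply: ler_sum => x _; apply: (@le_trans _ _ 1); first by rewrite lern1 leq_b1.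
  rewrite -{1}(sqrtr1 R) ler_wsqrtr// ler_pdivlMr// mul1r; apply: le_trans (ltW f0) _.
  rewrite (@f_level 0 (vzero m) x); last by move=> k; rewrite ltn0.
  exact: (le_bigmax _ (fun i : 'I_N.+1 => normc (f i x)) ord0).
have [K HK] := fejer_exceeds_layers f0.
have l2 : 0 < l / 2 by rewrite divr_gt0.
rewrite -(ler_pM2r l2) mulr_suml; apply: le_trans (ler_sum _ (fun x _ => HK x)) _.
rewrite exchange_big/=.
have stepk (k : 'I_K) : \sum_(x <- reps m N) \sum_(i < N) \sum_(u <- reps m i)
      (first_above f (tk k) i u)%:R * layer k i x u <=
    32 * B%:R ^+ 2 * l * \sum_(x <- reps m N) 2 ^+ k * (4 ^+ k < fmax f N x / e)%R%:R.
  rewrite exchange_big/=.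
  apply: (@le_trans _ _ (\sum_(i < N) 32 * B%:R * l * 2 ^+ k *
       \sum_(x <- reps m N) (first_above f (tk k) i x)%:R)).
    apply: ler_sum => i _; rewrite exchange_big/=.
    have Fi : level i (fun u => (first_above f (tk k) i u)%:R : R).
      by move=> x y xy; rewrite (level_first f_level (tk k) xy).
    have -> : \sum_(x <- reps m N) (first_above f (tk k) i x)%:R =
        (\sum_(u <- reps m i) (first_above f (tk k) i u)%:R) * ((M N)%:R / (M i)%:R) :> R.
      rewrite mulrA mulr_natr -(sum_reps_level m_ge2 (ltnW (ltn_ord i)) Fi).
      rewrite -[X in _ = X / _]mulr_natr mulfK//.
      by rewrite gt_eqF// MR_gt0.
    rewrite mulrCA mulr_suml; apply: ler_sum => u _.
    by rewrite -mulr_sumr ler_wpM2l// sum_layer// ltnW.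
  rewrite -mulr_sumr exchange_big/=.
  under eq_bigr do rewrite (sum_first _ _ _ _ (ltW (tk_gt0 k))).
  apply: le_trans (ler_wpM2l _ (sum_pmaxn_fmax m_ge2 m_leB f_level _ (ltW (tk_gt0 k)))) _.
    by rewrite !mulr_ge0 ?exprn_ge0// ltW.
  rewrite -mulr_sumr le_eqVlt; apply/orP; left; apply/eqP.
  under [X in _ = _ * (_ * X)]eq_bigr do rewrite ltr_pdivlMr//.
  by ring.
apply: le_trans (ler_sum _ (fun k _ => stepk k)) _.
rewrite -mulr_sumr exchange_big/=.
apply: (@le_trans _ _ (32 * B%:R ^+ 2 * l * \sum_(x <- reps m N) (2 * Num.sqrt (fmax f N x / e)))).
  rewrite ler_wpM2l//; first by rewrite !mulr_ge0 ?exprn_ge0// ltW.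
  apply: ler_sum => x _; apply: sum_pow2_sqrt; apply: divr_ge0; last exact: ltW.
  apply: le_trans (normc_ge0 (f 0 x)) _.
  exact: (le_bigmax _ (fun i : 'I_N.+1 => normc (f i x)) ord0).
rewrite -mulr_sumr le_eqVlt; apply/orP; left; apply/eqP; rewrite natrM natrX.
by field.
Qed.

End WeakType.

(** * Vilenkin polynomials as convolutions; summation by parts *)

Section Polynomials.
Variables (R : realType) (m : nat -> nat).
Hypothesis m_ge2 : forall k, (2 <= m k)%N.
Local Notation G := (vilenkin m).
Local Notation M := (Mprod m).
Local Notation normc := (@Normc.normc R).
Local Notation psi := (psi R).
Local Notation partial_sum := (@partial_sum R m).

Lemma level_partial_sum c s n : (n <= M s)%N -> level s (partial_sum c n).
Proof.
move=> ns x y xy; apply: eq_bigr => k _; congr (_ * _).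
by apply: (level_psi R m_ge2 _ xy); apply: leq_trans (ltn_ord k) ns.
Qed.

Lemma rad_upd n (x : G) (c : 'Z_(m n)) : rademacher R n (upd x c) = unit_root R m n c.
Proof. by rewrite rademacherE upd_in. Qed.

Lemma sum_root_Zm n b : (b < m n)%N ->
  \sum_(c : 'Z_(m n)) unit_root R m n c ^+ b = (if b == 0 then m n else 0%N)%:R.
Proof.
move=> bm; rewrite -(root_orth R m_ge2 bm (m_gt0 m_ge2 n)); apply: eq_bigr => c _.
by rewrite expr0 rmorph1 mulr1.
Qed.

(** Summing over the n-th coordinate kills every block of frequencies whose n-th digit is not 0. *)
Lemma partial_sum_avg c n x :
  \sum_(d : 'Z_(m n)) partial_sum c (M n.+1) (upd x d) = partial_sum c (M n) x *+ m n.
Proof.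
pose F b j := c (b * M n + j)%N * psi j x.
transitivity (\sum_(d : 'Z_(m n)) \sum_(b < m n) \sum_(j < M n) F b j * unit_root R m n d ^+ b).
  apply: eq_bigr => d _.
  rewrite (_ : M n.+1 = m n * M n + 0)%N; last by rewrite MprodS mulnC addn0.
  rewrite /Defs.partial_sum.
  rewrite (sum_block (m n) (M n) 0 (fun k => c k * psi k (upd x d))) big_ord0 addr0.
  apply: eq_bigr => b _; apply: eq_bigr => j _; rewrite psi_block// rad_upd /F.
  rewrite (level_psi R m_ge2 (ltn_ord j) (agree_upd x d)).
  by rewrite mulrCA mulrC.
rewrite exchange_big/= (bigD1 (Ordinal (m_gt0 m_ge2 n)))//= [X in _ + X]big1 ?addr0; last first.
  move=> b; rewrite -val_eqE/= => b0; rewrite exchange_big/= big1// => j _.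
  by rewrite -mulr_sumr sum_root_Zm// (negPf b0) mulr0.
rewrite exchange_big/= /Defs.partial_sum -sumrMnl; apply: eq_bigr => j _.
by rewrite -mulr_sumr sum_root_Zm ?m_gt0//= mulr_natr.
Qed.

Lemma psi_vsub n (x t : G) : psi n (vsub x t) = psi n x * Num.conj (psi n t).
Proof.
rewrite -[in RHS](translate_vsub x t) (psiD R m_ge2) -mulrA.
have -> : psi n t * Num.conj (psi n t) = 1.
  by rewrite -normCK normcE normc_psi expr1n.
by rewrite mulr1.
Qed.

Lemma conv_psi N c j x : (j < M N)%N ->
  conv N (partial_sum c (M N)) (psi j) x = (M N)%:R * (c j * psi j x).
Proof.
move=> jN; rewrite /conv /Defs.partial_sum.
under eq_bigr do rewrite mulr_suml.
rewrite exchange_big/=.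
have inner (i : 'I_(M N)) : \sum_(t <- reps m N) c i * psi i t * psi j (vsub x t) =
    c i * psi j x * (if i == j :> nat then M N else 0%N)%:R.
  rewrite -(psi_orth R m_ge2 (ltn_ord i) jN) mulr_sumr; apply: eq_bigr => t _.
  by rewrite psi_vsub mulrACA.
rewrite (eq_bigr _ (fun i _ => inner i)) (bigD1 (Ordinal jN))//= big1 ?addr0; last first.
  by move=> i; rewrite -val_eqE/= => /negPf ->; rewrite mulr0.
by rewrite eqxx mulrC.
Qed.

Lemma conv_fejer_sum N c n x : (n <= M N)%N ->
  conv N (partial_sum c (M N)) (fejer_sum R n) x =
  (M N)%:R * \sum_(k < n) partial_sum c k x.
Proof.
move=> nN; rewrite mulr_sumr.
transitivity (\sum_(k < n) \sum_(j < k) conv N (partial_sum c (M N)) (psi j) x).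
  rewrite /conv; under [RHS]eq_bigr do rewrite exchange_big/=.
  rewrite [RHS]exchange_big/=; apply: eq_bigr => t _.
  rewrite /fejer_sum mulr_sumr; apply: eq_bigr => k _.
  by rewrite /dirichlet mulr_sumr.
apply: eq_bigr => k _; rewrite /Defs.partial_sum mulr_sumr; apply: eq_bigr => j _.
by apply: conv_psi; apply: leq_trans nN; apply: ltn_trans (ltn_ord j) (ltn_ord k).
Qed.

Lemma normc_real (r : R) : 0 <= r -> normc r%:C = r.
Proof. by move=> r0; rewrite normcC ger0_norm. Qed.

(** After summation by parts the weights are q_n and the nonnegative increments of q, which
    telescope to at most q_n: hence the 2. *)
Lemma abel_bound (q : nat -> R) (S : nat -> R[i]) (l : R) n :
  nondecreasing_seq q -> (forall k, 0 <= q k) -> 0 <= l ->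
  (forall k, (0 < k <= n.+1)%N -> normc (\sum_(j < k) S j) <= l * k%:R) ->
  normc (\sum_(k < n.+1) (q k)%:C * S k) <= 2 * l * n.+1%:R * q n.
Proof.
move=> qn q0 l0 hS; pose A k := \sum_(j < k) S j.
have AS k : A k.+1 = A k + S k by rewrite /A big_ord_recr.
have abel : \sum_(k < n.+1) (q k)%:C * S k =
    (q n)%:C * A n.+1 - \sum_(k < n) (q k.+1 - q k)%:C * A k.+1.
  elim: n {hS} => [|n IH].
    by rewrite big_ord1 big_ord0 subr0 /A big_ord1.
  rewrite big_ord_recr/= IH [X in _ = _ - X]big_ord_recr/= (AS n.+1) rmorphB/=; ring.
rewrite abel; apply: le_trans (normcB _ _) _.
have h1 : normc ((q n)%:C * A n.+1) <= q n * (l * n.+1%:R).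
  by rewrite normcM normc_real// ler_wpM2l// hS//= leqnn.
have h2 : normc (\sum_(k < n) (q k.+1 - q k)%:C * A k.+1) <= q n * (l * n.+1%:R).
  apply: le_trans (normc_sum _ _ _) _.
  apply: (@le_trans _ _ (\sum_(k < n) (q k.+1 - q k) * (l * n.+1%:R))).
    apply: ler_sum => k _; have dq : 0 <= q k.+1 - q k by rewrite subr_ge0 qn.
    rewrite normcM normc_real// ler_wpM2l//; apply: le_trans (hS _ _) _.
      by rewrite /= ltnW// ltnS ltn_ord.
    by rewrite ler_wpM2l// ler_nat ltnW// ltnS ltn_ord.
  rewrite -mulr_suml ler_wpM2r ?mulr_ge0//.
  rewrite -(big_mkord xpredT (fun k => q k.+1 - q k)) telescope_sumr//.
  by rewrite gerBl.
lra.
Qed.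

End Polynomials.

(** * Haar measure of cells and integrals of functions of finite level *)

Section Haar.
Variables (R : realType) (m : nat -> nat).
Hypothesis m_ge2 : forall k, (2 <= m k)%N.
Local Notation G := (vilenkin m).
Local Notation M := (Mprod m).
Variable mu : probability G R.
Hypothesis mu_haar : translation_invariant mu.

Lemma open_coord k (c : 'Z_(m k)) : @open (vilenkin_top m) [set y : G | coord y k = c].
Proof.
pose K (i : nat) : topologicalType := discrete_topology 'Z_(m i).
apply: ((@continuousP (prod_topology K) (K k) (@proj nat K k)).1 _ [set c]).
  exact: (@proj_continuous nat K k).
exact: (@discrete_open (discrete_topology 'Z_(m k))).
Qed.

Lemma measurable_coord k (c : 'Z_(m k)) : measurable [set y : G | coord y k = c].
Proof. by apply: sub_sigma_algebra; exact: open_coord. Qed.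

Lemma measurable_samecyl n u : measurable [set x : G | samecyl n u x].
Proof.
elim: n => [|n IH].
  rewrite (_ : [set x | _] = setT); first exact: measurableT.
  by apply/seteqP; split => // x _; apply/samecylP => k; rewrite ltn0.
rewrite (_ : [set x | _] = [set x | samecyl n u x] `&` [set y | coord y n = coord u n]).
  by apply: measurableI => //; exact: measurable_coord.
apply/seteqP; split => x /=; first by rewrite samecylS => /andP[-> /eqP ->].
by move=> [h e]; rewrite samecylS h e eqxx.
Qed.

Lemma samecyl_indic n u (x : G) : \1_[set x | samecyl n u x] x = (samecyl n u x)%:R :> R.
Proof.
rewrite indicE; congr (_%:R); congr nat_of_bool; apply/idP/idP; first by rewrite inE.
by move=> h; rewrite inE.
Qed.

Lemma level_decomp N (F : G -> R) : level N F ->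
  (fun x => (F x)%:E) =
  (fun x => \sum_(u <- reps m N) ((F u)%:E * (\1_[set x | samecyl N u x] x)%:E)%E).
Proof.
move=> FN; apply/funext => x; rewrite -{1}(sum_reps_decomp x FN) -sumEFin.
by apply: eq_bigr => u _; rewrite samecyl_indic -EFinM mulrC.
Qed.

Lemma integrable_level N (F : G -> R) : level N F -> mu.-integrable setT (fun x => (F x)%:E).
Proof.
move=> FN; rewrite (level_decomp FN); apply: integrable_sum => // u _.
by apply: integrableZl => //; apply: integrable_indic; exact: measurable_samecyl.
Qed.

Lemma measurable_level N (F : G -> R) : level N F -> measurable_fun setT F.
Proof. by move=> /integrable_level/measurable_int/measurable_EFinP. Qed.

Lemma measurable_level_set N (E : G -> bool) : level N E -> measurable [set x | E x].
Proof.
move=> EN; apply/(measurable_indicP R).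
rewrite (_ : \1_ _ = fun x => (E x)%:R); last first.
  by apply/funext => x; rewrite indicE; congr (_%:R); congr nat_of_bool; apply/idP/idP;
    [rewrite inE|move=> h; rewrite inE].
by apply: (@measurable_level N) => x y /EN ->.
Qed.

Lemma integral_level_mu N (F : G -> R) : level N F ->
  (\int[mu]_x (F x)%:E = \sum_(u <- reps m N) (F u)%:E * mu [set x | samecyl N u x])%E.
Proof.
move=> FN; rewrite (level_decomp FN) integral_sum//; last first.
  by move=> u; apply: integrableZl => //; apply: integrable_indic; exact: measurable_samecyl.
apply: eq_bigr => u _; rewrite integralZl//; last first.
  by apply: integrable_indic; exact: measurable_samecyl.
by rewrite integral_indic ?setIT//; exact: measurable_samecyl.
Qed.

(** The M_N cells of level N are translates of one another and their measures add up to 1. *)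
Lemma mu_samecyl N u : mu [set x | samecyl N u x] = ((M N)%:R^-1)%:E.
Proof.
have tr v : mu [set x | samecyl N v x] = mu [set x | samecyl N (vzero m) x].
  rewrite -(mu_haar v (measurable_samecyl N (vzero m))); congr (mu _).
  apply/seteqP; split => [x /= /samecylP vx|_ [x /samecylP h <-]].
    exists (vsub x v); last exact: translate_vsub.
    by apply/samecylP => k kN; rewrite coord_vsub -vx// subrr.
  apply/samecylP => k kN; rewrite coord_translate -h//.
  by rewrite [coord (vzero m) k]/(0 : 'Z_(m k)) add0r.
rewrite tr; have fin : mu [set x | samecyl N (vzero m) x] \is a fin_num.
  by apply: fin_num_measure; exact: measurable_samecyl.
have := @integral_level_mu N (fun=> 1) (fun _ _ _ => erefl).
rewrite (_ : \int[mu]_x (1%:E : \bar R) = 1)%E; last by rewrite integral_cst//= mul1e; exact: probability_setT.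
under eq_bigr do rewrite mul1e tr.
rewrite -(fineK fin) sumEFin => -[] /esym; rewrite sum_reps_const// => e.
by congr EFin; apply/esym; apply: mulr1_eq; rewrite mulr_natl.
Qed.

Lemma integral_level N (F : G -> R) : level N F ->
  (\int[mu]_x (F x)%:E = ((M N)%:R^-1 * \sum_(u <- reps m N) F u)%:E)%E.
Proof.
move=> FN; rewrite (integral_level_mu FN) mulr_sumr -sumEFin; apply: eq_bigr => u _.
by rewrite mu_samecyl -EFinM mulrC.
Qed.

Lemma mu_level N (E : G -> bool) : level N E ->
  mu [set x | E x] = ((M N)%:R^-1 * \sum_(u <- reps m N) (E u)%:R)%:E.
Proof.
move=> EN; rewrite -[X in mu X]setIT -integral_indic//; last first.
  exact: measurable_level_set EN.
rewrite -(@integral_level N (fun x => (E x)%:R)); last by move=> x y /EN ->.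
apply: eq_integral => x _; rewrite indicE; congr EFin; congr (_%:R); congr nat_of_bool.
by apply/idP/idP; [rewrite inE|move=> h; rewrite inE].
Qed.

Lemma Re_sum I (s : seq I) (F : I -> R[i]) :
  complex.Re (\sum_(i <- s) F i) = \sum_(i <- s) complex.Re (F i).
Proof. by elim/big_rec2: _ => // i x y _ <-; case: (F i) => a b; case: y => c d. Qed.

Lemma Im_sum I (s : seq I) (F : I -> R[i]) :
  complex.Im (\sum_(i <- s) F i) = \sum_(i <- s) complex.Im (F i).
Proof. by elim/big_rec2: _ => // i x y _ <-; case: (F i) => a b; case: y => c d. Qed.

Lemma cintegral_level N (F : G -> R[i]) : level N F ->
  cintegral mu F = (M N)%:R^-1 * \sum_(u <- reps m N) F u.
Proof.
move=> FN; rewrite /cintegral /Rintegral.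
rewrite (@integral_level N (fun x => complex.Re (F x))); last by move=> x y /FN ->.
rewrite (@integral_level N (fun x => complex.Im (F x))); last by move=> x y /FN ->.
rewrite /= -Re_sum -Im_sum -(rmorph_nat (real_complex R)) -fmorphV/=.
case: (\sum_(u <- _) _) => a b; rewrite /real_complex_def.
by apply/eqP; rewrite eq_complex/= !mul0r subr0 addr0 !eqxx.
Qed.

Lemma fourier_partial_sum c N i : (i < M N)%N ->
  fourier mu (partial_sum c (M N)) i = c i.
Proof.
move=> iN; rewrite /fourier (@cintegral_level N); last first.
  move=> x y xy; rewrite (level_psi R m_ge2 iN xy).
  by rewrite (level_partial_sum m_ge2 c (leqnn _) xy).
rewrite /partial_sum; under eq_bigr do rewrite mulr_suml.
rewrite exchange_big/=.
under eq_bigr => k _ do under eq_bigr => u _ do rewrite -mulrA.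
under eq_bigr => k _ do rewrite -mulr_sumr (psi_orth R m_ge2 (ltn_ord k) iN).
rewrite (bigD1 (Ordinal iN))//= big1 ?addr0 ?eqxx; last first.
  by move=> k; rewrite -val_eqE/= => /negPf ->; rewrite mulr0.
by rewrite mulrCA mulVf ?mulr1// pnatr_eq0 -lt0n Mprod_gt0.
Qed.

End Haar.

(** * From finite levels to the group: the weak type inequality of part a) *)

Section WeakBound.
Variables (R : realType) (m : nat -> nat) (B : nat).
Hypothesis m_ge2 : forall k, (2 <= m k)%N.
Hypothesis m_leB : forall k, (m k <= B)%N.
Local Notation G := (vilenkin m).
Local Notation M := (Mprod m).
Local Notation normc := (@Normc.normc R).
Variable mu : probability G R.
Hypothesis mu_haar : translation_invariant mu.

(** By [martingaleE] every martingale has this form, so martingales are handled as arbitrary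
    coefficient sequences. *)
Definition mart_sum (c : nat -> R[i]) (n : nat) : G -> R[i] := partial_sum c (M n).

Lemma level_mart_sum c n : level n (mart_sum c n).
Proof. exact: level_partial_sum. Qed.

Lemma mart_sum_avg c n x : \sum_(d : 'Z_(m n)) mart_sum c n.+1 (upd x d) = mart_sum c n x *+ m n.
Proof. exact: partial_sum_avg. Qed.

(** The sequence whose limit defines the coefficient is constant from n on. *)
Lemma mfourier_martingale f i n : martingale mu f -> (i < M n)%N ->
  mfourier mu f i = fourier mu (f n) i.
Proof.
case=> _ _ fm iM.
have cst k l : (i < M k)%N -> (k <= l)%N -> fourier mu (f l) i = fourier mu (f k) i.
  move=> ik kl; rewrite -[in RHS](fm k l kl); apply/esym.
  exact: (fourier_partial_sum m_ge2 mu_haar).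
have hT : hausdorff_space (R[i]^o : normedModType R[i]) by exact: norm_hausdorff.
apply: (@lim_near_cst (R[i]^o : ptopologicalType) hT).
by exists n => // l nl; apply: cst.
Qed.

Lemma martingaleE f n : martingale mu f -> f n = mart_sum (mfourier mu f) n.
Proof.
move=> fm; have [_ _ fE] := fm; rewrite -{1}(fE n n (leqnn n)).
apply/funext => x; apply: eq_bigr => k _.
by rewrite (mfourier_martingale fm (ltn_ord k)).
Qed.

Lemma fejer_exceedsP c N l x :
  reflect (exists n, [/\ (0 < n < M N)%N & l * n%:R < normc (\sum_(k < n) partial_sum c k x)])
    (fejer_exceeds (mart_sum c) N l x).
Proof.
have key n : (n < M N)%N -> (l * n%:R * (M N)%:R < normc (conv N (mart_sum c N) (fejer_sum R n) x)) =
    (l * n%:R < normc (\sum_(k < n) partial_sum c k x)).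
  move=> nN; rewrite (conv_fejer_sum m_ge2 _ _ (ltnW nN)) normcM normc_nat mulrC.
  by rewrite ltr_pM2l// MR_gt0.
apply: (iffP existsP) => [[n /andP[n0]]|[n [/andP[n0 nN] h]]].
  by rewrite key// => h; exists n; rewrite n0 ltn_ord.
by exists (Ordinal nN); rewrite n0/= key.
Qed.

Lemma level_sum_partial c n N : (n <= M N)%N ->
  level N (fun x : G => \sum_(k < n) partial_sum c k x : R[i]).
Proof.
move=> nN x y xy; apply: eq_bigr => k _.
by apply: (level_partial_sum m_ge2 c _ xy); apply: leq_trans nN; exact: ltnW.
Qed.

Lemma level_fejer_exceeds c N l : level N (fejer_exceeds (mart_sum c) N l).
Proof.
suff imp x y : agree N x y -> fejer_exceeds (mart_sum c) N l x -> fejer_exceeds (mart_sum c) N l y.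
  by move=> x y xy; apply/idP/idP; apply: imp => //; exact: agree_sym.
move=> xy /fejer_exceedsP[n [nN h]]; apply/fejer_exceedsP; exists n; split; first exact: nN.
case/andP: nN => _ /ltnW nN.
by have := level_sum_partial c nN xy => /= <-.
Qed.

Lemma fejer_exceeds_mono c N N' l x : (N <= N')%N -> fejer_exceeds (mart_sum c) N l x -> fejer_exceeds (mart_sum c) N' l x.
Proof.
move=> NN' /fejer_exceedsP[n [/andP[n0 nN] h]]; apply/fejer_exceedsP; exists n; split => //.
by rewrite n0 (leq_trans nN)// leq_Mprod.
Qed.

Lemma maximal_ge (f : nat -> G -> R[i]) i x : ((normc (f i x))%:E <= maximal f x)%E.
Proof. by apply: ereal_sup_ubound; exists i. Qed.

Lemma maximal_ge0 (f : nat -> G -> R[i]) x : (0 <= maximal f x)%E.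
Proof. by apply: le_trans (maximal_ge f 0 x); rewrite lee_fin normc_ge0. Qed.

Lemma fmax_le_maximal (f : nat -> G -> R[i]) N x : ((fmax f N x)%:E <= maximal f x)%E.
Proof.
rewrite /fmax; elim/big_rec: _ => [|i y _ IH]; first exact: maximal_ge0.
by rewrite EFin_max ge_max IH maximal_ge.
Qed.

Lemma fmax_ge0 (f : nat -> G -> R[i]) N x : 0 <= fmax f N x.
Proof.
apply: le_trans (normc_ge0 (f 0 x)) _.
exact: (le_bigmax _ (fun i : 'I_N.+1 => normc (f i x)) ord0).
Qed.

Lemma level_fmax c N : level N (fmax (mart_sum c) N).
Proof.
move=> x y xy; apply: eq_bigr => i _.
have iN : (i <= N)%N by rewrite -ltnS.
by rewrite (level_mart_sum c (agreeW iN xy)).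
Qed.

Lemma measurable_maximal c : measurable_fun setT (maximal (mart_sum c)).
Proof.
rewrite (_ : maximal _ = fun x => esups (fun n => cabs (mart_sum c n) x) 0%N).
  apply: measurable_fun_esups => n; apply/measurable_EFinP.
  by apply: (@measurable_level _ _ mu n) => x y /level_mart_sum ->.
apply/funext => x; rewrite /maximal /esups /sdrop/=; congr ereal_sup.
by apply/seteqP; split => _ [k _ <-]; exists k.
Qed.

Lemma integral_sqrt_fmax c N :
  (((M N)%:R^-1 * \sum_(u <- reps m N) Num.sqrt (fmax (mart_sum c) N u))%:E <=
   \int[mu]_x (`|maximal (mart_sum c) x| `^ 2^-1))%E.
Proof.
have sN : level N (fun x => Num.sqrt (fmax (mart_sum c) N x)).
  by move=> x y /level_fmax ->.
rewrite -(integral_level m_ge2 mu_haar sN); apply: ge0_le_integral => //.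
- by apply/measurable_EFinP; exact: (measurable_level mu sN).
- apply: (@measurableT_comp _ _ _ _ _ _ (fun y => y `^ 2^-1)%E); first exact: measurable_poweR.
  apply: measurableT_comp => //; exact: measurable_maximal.
move=> x _; rewrite gee0_abs ?maximal_ge0// -powR12_sqrt ?fmax_ge0// -poweR_EFin.
by apply: gt0_ler_poweR; rewrite ?invr_ge0// ?in_itv/= ?leey ?andbT ?lee_fin ?fmax_ge0 ?maximal_ge0 ?fmax_le_maximal.
Qed.

Lemma Qsum_gt0 (q : nat -> R) n : (forall k, 0 <= q k) -> 0 < q 0%N -> 0 < Qsum q n.+1.
Proof.
move=> q0 q00; rewrite /Qsum big_ord_recl/= ltr_pwDl// sumr_ge0//.
Qed.

(** The growth hypothesis speaks only of large n. Below its threshold N0 one has n <= N0 and q_(n-1)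
    <= Q_n, so adding N0 to the constant covers all n. *)
Lemma ratio_bound (q : nat -> R) : (forall k, 0 <= q k) -> 0 < q 0%N ->
  (fun n : nat => q n.-1 / Qsum q n : R^o) =O_\oo (fun n : nat => n%:R^-1 : R^o) ->
  exists2 C : R, 0 < C & forall n, n.+1%:R * q n <= C * Qsum q n.+1.
Proof.
move=> q0 q00 /eqO_exP[k k0 [N0 _ H]].
exists (k + N0%:R) => [|n]; first by rewrite ltr_wpDr.
have Q0 := Qsum_gt0 n q0 q00.
have n0 : 0 < n.+1%:R :> R by [].
have [h|h] := leqP N0 n.+1.
  have := H _ h; rewrite /= [X in X <= _]ger0_norm; last by apply: divr_ge0; [exact: q0|exact: ltW].
  rewrite ger0_norm ?invr_ge0// ler_pdivrMr// mulrAC ler_pdivlMr// mulrC => /le_trans; apply.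
  by rewrite (ler_wpM2r (ltW Q0))// lerDl.
have h1 : n.+1%:R <= k + N0%:R.
  have : n.+1%:R <= N0%:R :> R by rewrite ler_nat; exact: ltnW.
  lra.
have h2 : q n <= Qsum q n.+1 by rewrite /Qsum big_ord_recr/= lerDr sumr_ge0.
exact: (ler_pM (ltW n0) (q0 n) h1 h2).
Qed.

Lemma Tmean_le q f n N l x : nondecreasing_seq q -> (forall k, 0 <= q k) -> 0 < q 0%N ->
  0 <= l -> (n.+1 < M N)%N -> ~~ fejer_exceeds (mart_sum (mfourier mu f)) N l x ->
  normc (Tmean mu q n.+1 f x) <= 2 * l * (n.+1%:R * q n) / Qsum q n.+1.
Proof.
move=> qn q0 q00 l0 nN /fejer_exceedsP nb; have Q0 := Qsum_gt0 n q0 q00.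
have Qi0 : 0 <= (Qsum q n.+1)^-1 by rewrite invr_ge0 ltW.
rewrite /Tmean normcM normcC (ger0_norm Qi0) mulrC (ler_wpM2r Qi0)//.
rewrite mulrA; apply: (abel_bound (S := fun k => msum mu f k x) qn q0 l0) => k /andP[k0 kn].
rewrite leNgt; apply/negP => h; apply: nb; exists k; split; last exact: h.
by rewrite k0 (leq_ltn_trans kn).
Qed.

Lemma level_Tmean q n f s : (n <= M s)%N -> level s (Tmean mu q n f).
Proof.
move=> ns x y xy; rewrite /Tmean.
set S1 := (X in _ * X = _); set S2 := (X in _ = _ * X); suff -> : S1 = S2 by [].
rewrite /S1 /S2.
apply: eq_bigr => k _.
apply: (congr1 (GRing.mul _)).
exact: (@level_partial_sum R m m_ge2 (mfourier mu f) s k (leq_trans (ltnW (ltn_ord k)) ns) x y xy).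
Qed.

Lemma mu_fejer_exceeds_le c l N : 0 < l ->
  (mu [set x | fejer_exceeds (mart_sum c) N l x] <=
   (128 * B ^ 2)%:R%:E * (Num.sqrt (l / (14 * B ^ 3)%:R))^-1%:E *
      \int[mu]_x (`|maximal (mart_sum c) x| `^ 2^-1))%E.
Proof.
move=> l0; rewrite (mu_level m_ge2 mu_haar (@level_fejer_exceeds c N l)).
have W := weak_type_fejer m_ge2 m_leB (@level_mart_sum c) (@mart_sum_avg c) N l0.
have e0 : 0 <= l / (14 * B ^ 3)%:R by rewrite divr_ge0// ltW.
have S : \sum_(x <- reps m N) Num.sqrt (fmax (mart_sum c) N x / (l / (14 * B ^ 3)%:R)) =
  (\sum_(x <- reps m N) Num.sqrt (fmax (mart_sum c) N x)) * (Num.sqrt (l / (14 * B ^ 3)%:R))^-1.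
  by rewrite mulr_suml; apply: eq_bigr => x _; rewrite sqrtrM ?fmax_ge0// sqrtrV.
rewrite S in W.
apply: (@le_trans _ _ ((128 * B ^ 2)%:R%:E * (Num.sqrt (l / (14 * B ^ 3)%:R))^-1%:E *
   ((M N)%:R^-1 * \sum_(u <- reps m N) Num.sqrt (fmax (mart_sum c) N u))%:E)%E).
  rewrite -!EFinM lee_fin mulrCA; apply: ler_wpM2l; first by rewrite invr_ge0.
  by apply: (le_trans W); rewrite -mulrA [X in _ * X]mulrC.
apply: lee_wpmul2l; last exact: integral_sqrt_fmax.
by rewrite -EFinM lee_fin mulr_ge0// invr_ge0 sqrtr_ge0.
Qed.

Theorem Tmaximal_weak_type q : nondecreasing_seq q -> (forall k, 0 <= q k) -> 0 < q 0%N ->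
  (fun n : nat => q n.-1 / Qsum q n : R^o) =O_\oo (fun n : nat => n%:R^-1 : R^o) ->
  bounded_from_hardy mu 2^-1 (weak_norm mu 2^-1) (Tmaximal mu q).
Proof.
move=> qn q0 q00 qO; have [C C0 HC] := ratio_bound q0 q00 qO.
pose K : R := (128 * B ^ 2)%:R; pose D : R := (14 * B ^ 3)%:R.
have B0 : (0 < B)%N by apply: leq_trans (m_leB 0); apply: ltnW.
have D0 : 0 < D by rewrite ltr0n muln_gt0 expn_gt0 B0.
exists (K ^+ 2 * (2 * C * D)) => f [fm fH].
have fE : f = mart_sum (mfourier mu f) by apply/funext => n; apply: martingaleE.
set c := mfourier mu f in fE.
rewrite /hardy_norm unlock in fH *.
set H := (\int[mu]_x _)%E in fH *.
have Hfin : H \is a fin_num.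
  rewrite ge0_fin_numE; last by apply: integral_ge0 => x _; exact: poweR_ge0.
  by apply: lty_poweRy fH; rewrite invr_neq0 ?invr_eq0.
have H0 : (0 <= H)%E by apply: integral_ge0 => x _; exact: poweR_ge0.
set h := fine H; have HE : H = h%:E by rewrite fineK.
have h0 : 0 <= h by apply: fine_ge0.
have sq (v : R) : 0 <= v -> (v%:E `^ 2^-1^-1)%E = (v ^+ 2)%:E.
  by move=> v0; rewrite poweR_EFin invrK powR_mulrn.
rewrite HE sq// -EFinM; apply: ge_ereal_sup => _ [l l0 <-].
have {}l0 : 0 < l by move: l0; rewrite /= in_itv/= andbT.
set E := [set x | _].
(* With this height the bound 2 a n q_(n-1) / Q_n on the T means is at most l. *)
pose a := l / (2 * C).
have a0 : 0 < a by rewrite divr_gt0// mulr_gt0.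
pose Ba := \bigcup_N [set x | fejer_exceeds (mart_sum c) N a x].
have mb N : measurable [set x | fejer_exceeds (mart_sum c) N a x].
  exact: (measurable_level_set mu (@level_fejer_exceeds c N a)).
have mBa : measurable Ba by exact: bigcup_measurable.
pose En n : set G := [set x | (0 < n)%N && (l < normc (Tmean mu q n f x))].
have mE : measurable E.
  rewrite (_ : E = \bigcup_n En n).
    apply: bigcup_measurable => n _.
    apply: (@measurable_level_set _ _ mu n) => x y xy.
    by rewrite (level_Tmean q f (ltnW (ltn_Mprod m_ge2 n)) xy).
  apply/seteqP; split => x.
    rewrite /E/= gee0_abs; last first.
      apply: (@le_trans _ _ (cabs (Tmean mu q 1 f) x)); first by rewrite lee_fin normc_ge0.
      by apply: ereal_sup_ubound; exists 1%N.
    by case/ereal_sup_gt => _ [n /= n0 <-] ln; exists n => //; rewrite /En/= n0.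
  case=> n _ /andP[n0 ln]; rewrite /E/=; apply: lt_le_trans (lee_abs _).
  apply: (@lt_le_trans _ _ (cabs (Tmean mu q n f) x)); first by rewrite lte_fin.
  by apply: ereal_sup_ubound; exists n.
have EB : E `<=` Ba.
  move=> x; rewrite /E/= gee0_abs; last first.
    apply: (@le_trans _ _ (cabs (Tmean mu q 1 f) x)); first by rewrite lee_fin normc_ge0.
    by apply: ereal_sup_ubound; exists 1%N.
  case/ereal_sup_gt => _ [[//|n] /= _ <-]; rewrite lte_fin => ln.
  exists n.+1 => //=; have [//|nb] := boolP (fejer_exceeds (mart_sum c) n.+1 a x); exfalso.
  have := Tmean_le qn q0 q00 (ltW a0) (ltn_Mprod m_ge2 n.+1) nb.
  rewrite leNgt => /negP; apply; apply: le_lt_trans ln.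
  rewrite ler_pdivrMr ?Qsum_gt0//.
  apply: (@le_trans _ _ (2 * a * (C * Qsum q n.+1))).
    by rewrite ler_wpM2l// mulr_ge0// ltW.
  by rewrite le_eqVlt; apply/orP; left; apply/eqP; rewrite /a; field; rewrite gt_eqF.
pose b : R := K * (Num.sqrt (a / D))^-1 * h.
have b0 : 0 <= b by rewrite !mulr_ge0// invr_ge0 sqrtr_ge0.
have muB : (mu Ba <= b%:E)%E.
  (* The sets increase with N and their measures have a bound independent of N: continuity from
     below. *)
  have cv : (mu \o (fun N => [set x | fejer_exceeds (mart_sum c) N a x])) x @[x --> \oo] --> mu Ba.
    apply: nondecreasing_cvg_mu => // N N' NN'; apply/subsetPset => x /=.
    exact: fejer_exceeds_mono.
  rewrite -(cvg_lim _ cv)//; apply: lime_le; first by apply/cvg_ex; exists (mu Ba).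
  apply: nearW => N /=; apply: le_trans (mu_fejer_exceeds_le c N a0) _.
  by rewrite -fE -/H HE -!EFinM lee_fin.
have muE : (mu E <= b%:E)%E.
  by apply: le_trans muB; apply: le_measure; rewrite ?inE.
apply: (@le_trans _ _ (l%:E * (b%:E `^ 2^-1^-1))%E).
  rewrite lee_pmul2l//; apply: gt0_ler_poweR => //; rewrite ?in_itv/= ?leey ?andbT ?measure_ge0//.
rewrite sq// -EFinM lee_fin /b !exprMn exprVn sqr_sqrtr; last first.
  by rewrite divr_ge0 ?ltW.
rewrite le_eqVlt; apply/orP; left; apply/eqP; rewrite /a; field.
by rewrite (gt_eqF C0) (gt_eqF l0) pnatr_eq0 -lt0n B0.
Qed.

End WeakBound.

(** * Subadditivity of powers with exponent at most 1 *)

Section PowR.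
Variable R : realType.

(** With s = a + b, the ratio x/s lies in [0, 1] and is at most its p-th power; multiply by s^p and
    add for x = a and x = b. *)
Lemma powRD_le (p a b : R) : 0 < p <= 1 -> 0 <= a -> 0 <= b ->
  (a + b) `^ p <= a `^ p + b `^ p.
Proof.
case/andP => p0 p1 a0 b0; have [s0|s0] := eqVneq (a + b) 0.
  by rewrite s0 powR0 ?gt_eqF// addr_ge0// powR_ge0.
have sp : 0 < a + b by rewrite lt_neqAle eq_sym s0 addr_ge0.
have key x : 0 <= x -> x <= a + b -> (a + b) `^ p * (x / (a + b)) <= x `^ p.
  move=> x0 xs; have [->|xn] := eqVneq x 0; first by rewrite mul0r mulr0 powR_ge0.
  have xp : 0 < x by rewrite lt_neqAle eq_sym xn.
  have -> : x `^ p = (a + b) `^ p * (x / (a + b)) `^ p.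
    by rewrite -powRM ?divr_ge0 ?(ltW sp)// mulrC divfK.
  rewrite ler_wpM2l ?powR_ge0// ger1_powR// divr_gt0//= ler_pdivrMr// mul1r //.
have h1 : a <= a + b by lra.
have h2 : b <= a + b by lra.
have := lerD (key a a0 h1) (key b b0 h2).
by rewrite -mulrDr -mulrDl divff// mulr1.
Qed.

Lemma powR_sum_le (p : R) n (a : nat -> R) : 0 < p <= 1 -> (forall k, 0 <= a k) ->
  (\sum_(k < n) a k) `^ p <= \sum_(k < n) a k `^ p.
Proof.
move=> p01 a0; elim: n => [|n IH].
  by rewrite !big_ord0 powR0//; case/andP: p01 => p0 _; rewrite gt_eqF.
rewrite !big_ord_recr/=; apply: le_trans (powRD_le p01 _ (a0 n)) _; first exact: sumr_ge0.
by rewrite lerD2r.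
Qed.

Lemma sum_geom_le (r : R) n : 0 <= r < 1 -> \sum_(k < n) r ^+ k <= (1 - r)^-1.
Proof.
case/andP => r0 r1; have s0 : 0 < 1 - r by rewrite subr_gt0.
rewrite -(ler_pM2l s0) divff ?gt_eqF// -opprB mulNr -subrX1 opprB.
by rewrite gerBl exprn_ge0.
Qed.

End PowR.

(** * Martingales with coefficients constant on blocks *)

Section Counterexample.
Variables (R : realType) (m : nat -> nat) (B : nat).
Hypothesis m_ge2 : forall k, (2 <= m k)%N.
Hypothesis m_leB : forall k, (m k <= B)%N.
Local Notation G := (vilenkin m).
Local Notation M := (Mprod m).
Local Notation normc := (@Normc.normc R).
Local Notation psi := (psi R).
Variable mu : probability G R.
Hypothesis mu_haar : translation_invariant mu.

Lemma mart_sum_martingale c : martingale mu (mart_sum c : nat -> G -> R[i]).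
Proof.
split.
- move=> n; split; apply: (@integrable_level _ _ mu n) => x y xy;
    by rewrite (level_mart_sum m_ge2 c xy).
- move=> n.
  have meas (F : G -> R) : level n F ->
      measurable_fun [set: g_sigma_algebraType (range (@cylinder m n))] F.
    move=> Fn; rewrite (_ : F = fun x => \sum_(u <- reps m n)
        \1_[set x | samecyl n u x] x * F u); last first.
      apply/funext => x; rewrite -(sum_reps_decomp x Fn).
      by apply: eq_bigr => u _; rewrite samecyl_indic.
    apply: measurable_sum => u; apply: measurable_funM => //.
    apply: measurable_indic; apply: sub_sigma_algebra; exists u => //.
    by apply/seteqP; split => x /=; [move=> h; apply/samecylP => k kn; rewrite h
                                    |move=> /samecylP h k kn; rewrite h].
  by split; apply: meas => x y xy; rewrite (level_mart_sum m_ge2 c xy).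
- move=> n l nl; apply/funext => x; apply: eq_bigr => k _; congr (_ * _).
  apply: (fourier_partial_sum m_ge2 mu_haar).
  by apply: leq_trans (ltn_ord k) _; apply: leq_Mprod.
Qed.

Lemma mfourier_mart_sum c i : mfourier mu (mart_sum c : nat -> G -> R[i]) i = c i.
Proof.
have iM := ltn_Mprod m_ge2 i.
rewrite (mfourier_martingale m_ge2 mu_haar (mart_sum_martingale c) iM).
exact: (fourier_partial_sum m_ge2 mu_haar).
Qed.

(** At most one k satisfies the condition, so the sum selects the block of j without computing a
    logarithm; it is 0 at j = 0. *)
Definition layer_coef (d : nat -> R) (j : nat) : R[i] :=
  (\sum_(k < j.+1 | (M k <= j < M k.+1)%N) d k)%:C.

Lemma layer_coefE d k j : (M k <= j < M k.+1)%N -> layer_coef d j = (d k)%:C.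
Proof.
move=> kj; have kj1 : (k < j.+1)%N.
  by case/andP: kj => h _; have := ltn_Mprod m_ge2 k; lia.
rewrite /layer_coef (bigD1 (Ordinal kj1))//= big1 ?addr0// => i /andP[ij].
rewrite -val_eqE/= => ik; exfalso; case/andP: kj ij => k1 k2 /andP[i1 i2].
move: ik; rewrite neq_ltn => /orP[h|h].
  by have := leq_Mprod m_ge2 h; lia.
by have := leq_Mprod m_ge2 h; lia.
Qed.

Lemma mart_sum_layerS d n (x : G) : mart_sum (layer_coef d) n.+1 x =
  mart_sum (layer_coef d) n x + (d n)%:C * (dirichlet R (M n.+1) x - dirichlet R (M n) x) :> R[i].
Proof.
have MM : (M n <= M n.+1)%N by apply: leq_Mprod.
have split (F : nat -> R[i]) : \sum_(j < M n.+1) F j =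
    \sum_(j < M n) F j + \sum_(M n <= j < M n.+1) F j.
  by rewrite -!(big_mkord xpredT F) -big_cat_nat.
rewrite /mart_sum /partial_sum (split (fun j => layer_coef d j * psi j x)); congr (_ + _).
rewrite /dirichlet (split (fun j => psi j x)) addrAC subrr add0r mulr_sumr.
by apply: eq_big_nat => j jn; rewrite (layer_coefE d jn).
Qed.

Lemma mart_sum_layer0 d (x : G) : mart_sum (layer_coef d) 0 x = 0 :> R[i].
Proof.
rewrite /mart_sum /partial_sum Mprod0 big_ord1 /layer_coef big1 ?mul0r// => k.
by rewrite leqn0 => /andP[/eqP h]; have := Mprod_gt0 m_ge2 k; rewrite h.
Qed.

Lemma Jset_diag k (x : G) : Jset k k x = samecyl k (vzero m) x.
Proof.
apply/JsetP/samecylP => [h j jk|h j jk _]; last by rewrite -h.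
by rewrite h//; apply: contraTneq jk => ->; rewrite ltnn.
Qed.

(** The k-th increment is d_k times the difference of the Dirichlet kernels at M_(k+1) and M_k,
    which lives on the k-th cell around 0 and is at most 2 B M_k. *)
Lemma mart_sum_layer_le d N (x : G) : (forall k, 0 <= d k) ->
  normc (mart_sum (layer_coef d) N x) <=
  \sum_(k < N) d k * (2 * B * M k)%:R * (samecyl k (vzero m) x)%:R.
Proof.
move=> d0; elim: N => [|N IH]; first by rewrite mart_sum_layer0 Normc.normc0 big_ord0.
rewrite mart_sum_layerS big_ord_recr/=; apply: le_trans (normcD _ _) _; apply: lerD => //.
rewrite normcM normc_real// -mulrA ler_wpM2l//; apply: le_trans (normcB _ _) _.
rewrite !dirichlet_Mprod// !normc_nat !Jset_diag.
have B1 : (1 <= B)%N by apply: leq_trans (m_leB 0); apply: ltnW.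
have MB : (M N.+1 <= B * M N)%N by rewrite MprodS mulnC leq_mul2r m_leB orbT.
rewrite samecylS; case: samecyl => /=; last by rewrite mulr0 addr0.
rewrite mulr1 -natrD ler_nat.
have h : (M N <= B * M N)%N by rewrite leq_pmull.
by case: ifP => _; nia.
Qed.

Lemma mu_diag k : (\int[mu]_x ((samecyl k (vzero m) x)%:R : R)%:E = ((M k)%:R^-1)%:E)%E.
Proof.
rewrite (integral_level m_ge2 mu_haar (N:=k)); last first.
  by move=> x y xy; rewrite samecylC (level_samecyl _ (leqnn k) xy) samecylC.
congr EFin; rewrite -[RHS]mulr1; congr (_ * _).
have h := sum_samecyl R m_ge2 (vzero m) (leqnn k).
by apply: (mulIf (x := (M k)%:R)); rewrite ?h ?mul1r// gt_eqF ?MR_gt0.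
Qed.

End Counterexample.

(** * Membership in the Hardy space and unbounded weak norms: part b) *)

Section UnboundedMeans.
Variables (R : realType) (m : nat -> nat) (B : nat).
Hypothesis m_ge2 : forall k, (2 <= m k)%N.
Hypothesis m_leB : forall k, (m k <= B)%N.
Local Notation G := (vilenkin m).
Local Notation M := (Mprod m).
Local Notation normc := (@Normc.normc R).
Local Notation psi := (psi R).
Variable mu : probability G R.
Hypothesis mu_haar : translation_invariant mu.

Lemma maximal_poweR_le p (d : nat -> R) (x : G) : 0 < p <= 1 -> (forall k, 0 <= d k) ->
  (`|maximal (mart_sum (layer_coef m d)) x| `^ p <=
   \sum_(k <oo) (((d k * (2 * B * M k)%:R) `^ p)%:E * ((samecyl k (vzero m) x)%:R : R)%:E))%E.
Proof.
move=> p01 d0; have /andP[p0 p1] := p01.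
pose u k := (((d k * (2 * B * M k)%:R) `^ p)%:E * ((samecyl k (vzero m) x)%:R : R)%:E)%E.
have u0 k : (0 <= u k)%E.
  by rewrite /u -EFinM lee_fin mulr_ge0// powR_ge0.
set S := (X in (_ <= X)%E); have S0 : (0 <= S)%E by apply: nneseries_ge0 => k _ _; exact: u0.
have pi0 : 0 <= p^-1 by rewrite invr_ge0 ltW.
(* The supremum is taken inside the power p, so each term is first bounded by a quantity independent
   of N. *)
have key N : ((normc (mart_sum (layer_coef m d) N x))%:E <= S `^ p^-1)%E.
  have -> : normc (mart_sum (layer_coef m d) N x) =
      (normc (mart_sum (layer_coef m d) N x) `^ p) `^ p^-1.
    by rewrite -powRrM mulfV ?gt_eqF// powRr1// normc_ge0.
  rewrite -poweR_EFin; apply: gt0_ler_poweR => //;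
    rewrite ?in_itv/= ?leey ?andbT ?lee_fin ?powR_ge0//.
  apply: (@le_trans _ _ (\sum_(0 <= k < N) u k)%E); last exact: nneseries_lim_ge.
  rewrite big_mkord /u; under eq_bigr do rewrite -EFinM.
  rewrite sumEFin lee_fin.
  have a0 k : 0 <= d k * (2 * B * M k)%:R * (samecyl k (vzero m) x)%:R by rewrite !mulr_ge0.
  apply: (@le_trans _ _ ((\sum_(k < N) d k * (2 * B * M k)%:R * (samecyl k (vzero m) x)%:R) `^ p)).
    apply: ge0_ler_powR; rewrite ?nnegrE ?normc_ge0 ?sumr_ge0 ?(ltW p0)//.
    exact: mart_sum_layer_le.
  apply: le_trans (powR_sum_le N p01 a0) _; apply: ler_sum => k _.
  by case: samecyl; rewrite ?mulr1// !mulr0 powR0// gt_eqF.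
rewrite gee0_abs ?maximal_ge0//.
have -> : S = ((S `^ p^-1) `^ p)%E by rewrite -poweRrM mulVf ?gt_eqF// poweRe1.
apply: gt0_ler_poweR; rewrite ?(ltW p0) ?in_itv/= ?leey ?andbT ?maximal_ge0 ?poweR_ge0//.
by apply: ge_ereal_sup => _ [N _ <-]; exact: key.
Qed.

(** The p-th power of the k-th increment is of order M_k^(1/2 + p) on a cell of measure 1/M_k; the
    integrals M_k^(p - 1/2) are dominated by a geometric series because M_k >= 2^k. *)
Lemma hardy_layer (p : R) : 0 < p -> p < 2^-1 ->
  hardy mu p (mart_sum (layer_coef m (fun k => (M k)%:R `^ (2 * p)^-1)) : nat -> G -> R[i]).
Proof.
move=> p0 p2; set d := (fun k => _); split; first exact: (mart_sum_martingale m_ge2 mu_haar).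
have d0 k : 0 <= d k by exact: powR_ge0.
have p01 : 0 < p <= 1 by rewrite p0/=; have := p2; lra.
rewrite /hardy_norm unlock; apply: poweR_lty.
pose a k : R := (d k * (2 * B * M k)%:R) `^ p.
have ge0 k (x : G) : (0 <= (a k)%:E * ((samecyl k (vzero m) x)%:R : R)%:E)%E.
  by rewrite -EFinM lee_fin mulr_ge0// powR_ge0.
have lev k : level k (fun x : G => (samecyl k (vzero m) x)%:R : R).
  by move=> x y xy; rewrite samecylC (level_samecyl _ (leqnn k) xy) samecylC.
have meas k : measurable_fun setT (fun x : G => (a k)%:E * ((samecyl k (vzero m) x)%:R : R)%:E)%E.
  rewrite (_ : (fun _ => _) = fun x : G => (a k * (samecyl k (vzero m) x)%:R)%:E).
    apply/measurable_EFinP; apply: (measurable_level mu (N:=k)) => x y xy.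
    by rewrite (lev k x y xy).
  by apply/funext => x; rewrite EFinM.
apply: (@le_lt_trans _ _
   (\int[mu]_x \sum_(k <oo) ((a k)%:E * ((samecyl k (vzero m) x)%:R : R)%:E))%E).
  apply: ge0_le_integral.
  - exact: measurableT.
  - by move=> x _; exact: poweR_ge0.
  - apply: (@measurableT_comp _ _ _ _ _ _ (fun y => y `^ p)%E); first exact: measurable_poweR.
    by apply: measurableT_comp => //; exact: (measurable_maximal m_ge2 mu).
  - by apply: ge0_emeasurable_sum.
  - by move=> x _; apply: maximal_poweR_le.
rewrite integral_nneseries//.
pose e := 2^-1 - p; have e0 : 0 < e by rewrite /e; have := p2; lra.
pose r : R := (2 `^ e)^-1.
have r01 : 0 <= r < 1.
  rewrite invr_ge0 powR_ge0/= invf_lt1 ?powR_gt0//.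
  have -> : (1 < 2 `^ e) = (1 `^ e < 2 `^ e) by rewrite powR1.
  by rewrite gt0_ltr_powR ?nnegrE//; lra.
pose C : R := (2 * B)%:R `^ p.
have term k : (\int[mu]_x ((a k)%:E * ((samecyl k (vzero m) x)%:R : R)%:E) <= (C * r ^+ k)%:E)%E.
  rewrite ge0_integralZl_EFin//; last 2 first.
  - by apply/measurable_EFinP; exact: (measurable_level mu (lev k)).
  - exact: powR_ge0.
  rewrite (mu_diag m_ge2 mu_haar) -EFinM lee_fin.
  have Mk := MR_gt0 R m_ge2 k.
  have -> : a k = C * ((M k)%:R `^ (2^-1 + p)).
    rewrite /a /d natrM mulrCA powRM ?mulr_ge0 ?powR_ge0//; congr (_ * _).
    have h2p : 0 < 2^-1 + p by rewrite addr_gt0.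
    rewrite powRM ?powR_ge0// -powRrM powRD ?(gt_eqF h2p)//.
    by congr (_ `^ _ * _); field; rewrite gt_eqF.
  rewrite -mulrA ler_wpM2l ?powR_ge0//.
  have -> : (M k)%:R `^ (2^-1 + p) / (M k)%:R = ((M k)%:R `^ e)^-1.
    rewrite -powRN -[X in _ / X](powRr1 (ltW Mk)) -[X in _ * X]powRN -powRD; last by rewrite (gt_eqF Mk) implybT.
    by congr powR; rewrite /e; lra.
  rewrite /r exprVn lef_pV2 ?posrE ?exprn_gt0 ?powR_gt0//.
  rewrite -powR_mulrn ?powR_ge0// -powRrM mulrC powRrM powR_mulrn//.
  apply: ge0_ler_powR; rewrite ?nnegrE ?(ltW e0) ?exprn_ge0//.
  rewrite -natrX ler_nat; have := Mprod_pow2 m_ge2 0 k.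
  by rewrite Mprod0 muln1 addn0.
apply: (@le_lt_trans _ _ (C / (1 - r))%:E); last exact: ltry.
apply: lime_le.
  by apply: is_cvg_nneseries => k _ _; apply: integral_ge0 => x _; exact: ge0.
apply: nearW => n; apply: (@le_trans _ _ (\sum_(0 <= k < n) (C * r ^+ k)%:E)%E).
  by apply: lee_sum => k _; exact: term.
rewrite sumEFin lee_fin big_mkord -mulr_sumr ler_wpM2l ?powR_ge0//.
exact: sum_geom_le.
Qed.

(* q_n S_n = Q_(n+1) T_(n+1) - Q_n T_n, and Q_n <= n q_n because q is monotone. *)
Lemma partial_sum_le_Tmean (q : nat -> R) f n (x : G) :
  nondecreasing_seq q -> (forall k, 0 <= q k) -> 0 < q 0%N -> (0 < n)%N ->
  normc (msum mu f n x) <=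
  n.+1%:R * normc (Tmean mu q n.+1 f x) + n%:R * normc (Tmean mu q n f x).
Proof.
move=> qn q0 q00; case: n => // n _.
have qn0 k : 0 < q k by apply: lt_le_trans q00 _; apply: qn.
have Q0 k : 0 < Qsum q k.+1 by exact: Qsum_gt0.
have QT k : (Qsum q k.+1)%:C * Tmean mu q k.+1 f x = \sum_(j < k.+1) (q j)%:C * msum mu f j x.
  by rewrite /Tmean mulrA -rmorphM/= divff ?gt_eqF// mul1r.
have id : (q n.+1)%:C * msum mu f n.+1 x =
    (Qsum q n.+2)%:C * Tmean mu q n.+2 f x - (Qsum q n.+1)%:C * Tmean mu q n.+1 f x.
  by rewrite !QT [X in _ = X - _]big_ord_recr/= addrAC subrr add0r.
have Qle k l : (k <= l.+1)%N -> Qsum q k <= k%:R * q l.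
  move=> kl; have -> : k%:R * q l = \sum_(i < k) q l by rewrite sumr_const card_ord mulr_natl.
  apply: ler_sum => i _; apply: qn.
  by rewrite -ltnS; apply: leq_trans (ltn_ord i) kl.
rewrite -(ler_pM2l (qn0 n.+1)) -{1}(normc_real (q0 n.+1)) -normcM id.
apply: le_trans (normcB _ _) _; rewrite (normcM (Qsum q n.+2)%:C) (normcM (Qsum q n.+1)%:C).
rewrite !normc_real ?(ltW (Q0 _))// mulrDr.
by apply: lerD; rewrite mulrA (mulrC (q _)) ler_wpM2r ?normc_ge0// Qle.
Qed.

(** S_(M_k + 1) - S_(M_k) has modulus d_k everywhere, so at each point one of the means of orders
    M_k, M_k + 1, M_k + 2 is large, and one of the three sets has measure at least 1/3. *)
Lemma Tmean_weak_lower (q : nat -> R) (d : nat -> R) (p K : R) k :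
  nondecreasing_seq q -> (forall k, 0 <= q k) -> 0 < q 0%N -> 0 < d k -> 0 < p ->
  (forall n, (0 < n)%N ->
     (weak_norm mu p (cabs (Tmean mu q n (mart_sum (layer_coef m d)))) <= K%:E)%E) ->
  d k / (24 * (M k)%:R) * 3^-1 `^ p^-1 <= K.
Proof.
move=> qn q0 q00 dk p0 HK; set f : nat -> G -> R[i] := mart_sum (layer_coef m d) in HK *.
have cE : mfourier mu f = layer_coef m d.
  by apply/funext => i; exact: (mfourier_mart_sum m_ge2 mu_haar).
have MR := MR_gt0 R m_ge2 k; have M0 := Mprod_gt0 m_ge2 k.
set t := d k / (24 * (M k)%:R).
(* If all three means were at most t, the two partial sums would add up to at most (1 + 2 + 2 + 3)
   M_k t = 8 M_k t; the 24 leaves ample room. *)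
have t0 : 0 < t by rewrite divr_gt0// mulr_gt0.
pose T n x := normc (Tmean mu q n f x).
have cover x : [|| t < T (M k) x, t < T (M k).+1 x | t < T (M k).+2 x].
  apply/negPn/negP; rewrite !negb_or -!leNgt => /and3P[h1 h2 h3].
  have s1 := partial_sum_le_Tmean f x qn q0 q00 M0.
  have s2 := partial_sum_le_Tmean f x qn q0 q00 (ltn0Sn (M k)).
  have : d k <= normc (msum mu f (M k).+1 x) + normc (msum mu f (M k) x).
    apply: le_trans (normcB _ _).
    rewrite /msum cE {1}/partial_sum big_ord_recr/= addrAC subrr add0r normcM normc_psi mulr1.
    have kk : (M k <= M k < M k.+1)%N by rewrite leqnn/= MprodS ltn_Pmulr.
    by rewrite (layer_coefE m_ge2 d kk) normc_real// ltW.
  rewrite -/(T _ x) -/(T _ x) in s1; rewrite -/(T _ x) -/(T _ x) in s2.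
  have M1 : 1 <= (M k)%:R :> R by rewrite ler1n.
  rewrite -!natr1 in s1 s2.
  have dt : d k = 24 * ((M k)%:R * t) by rewrite /t; field; rewrite gt_eqF.
  have g1 : (M k)%:R * T (M k) x <= (M k)%:R * t by rewrite ler_wpM2l.
  have g2 : ((M k)%:R + 1) * T (M k).+1 x <= 2 * (M k)%:R * t.
    by apply: ler_pM; rewrite ?addr_ge0 ?normc_ge0//; lra.
  have g3 : ((M k)%:R + 1 + 1) * T (M k).+2 x <= 3 * (M k)%:R * t.
    by apply: ler_pM; rewrite ?addr_ge0 ?normc_ge0//; lra.
  have Mt : 0 < (M k)%:R * t by rewrite mulr_gt0.
  lra.
have levT n : level n (fun x => t < T n x).
  move=> x y xy; rewrite /T.
  by rewrite (level_Tmean m_ge2 mu q f (ltnW (ltn_Mprod m_ge2 n)) xy).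
pose v n : R := (M n)%:R^-1 * \sum_(u <- reps m n) (t < T n u)%R%:R.
have muv n : mu [set x | t < T n x] = (v n)%:E by exact: (mu_level m_ge2 mu_haar (levT n)).
have mT n : measurable [set x | t < T n x] by exact: (measurable_level_set mu (levT n)).
have sumv : 1 <= v (M k) + v (M k).+1 + v (M k).+2.
  rewrite -lee_fin !EFinD -!muv -(probability_setT mu).
  apply: (@le_trans _ _ (mu ([set x | t < T (M k) x] `|` [set x | t < T (M k).+1 x] `|`
       [set x | t < T (M k).+2 x]))).
    apply: le_measure; rewrite ?inE//; first by apply: measurableU => //; apply: measurableU.
    by move=> x _; have /or3P[h|h|h] := cover x; [left; left|left; right|right].
  apply: le_trans (measureU2 _ _ _) _ => //; first exact: measurableU.
  by apply: leeD => //; exact: measureU2.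
have [n n0 vn] : exists2 n, (0 < n)%N & 3^-1 <= v n.
  have [h1|h1] := lerP 3^-1 (v (M k)); first by exists (M k).
  have [h2|h2] := lerP 3^-1 (v (M k).+1); first by exists (M k).+1.
  by exists (M k).+2 => //; lra.
rewrite -lee_fin; apply: le_trans (HK n n0).
apply: (@le_trans _ _ (t%:E * (mu [set x | (t%:E < `|cabs (Tmean mu q n f) x|)%E] `^ p^-1))%E); last first.
  by apply: ereal_sup_ubound; exists t => //; rewrite /= in_itv/= t0.
have -> : [set x | (t%:E < `|cabs (Tmean mu q n f) x|)%E] = [set x | t < T n x].
  have cT x : `|cabs (Tmean mu q n f) x|%E = (T n x)%:E by rewrite gee0_abs// lee_fin normc_ge0.
  by apply/seteqP; split => x; rewrite /mkset cT lte_fin.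
rewrite muv poweR_EFin -EFinM lee_fin ler_wpM2l ?(ltW t0)//.
apply: ge0_ler_powR; rewrite ?nnegrE ?invr_ge0 ?(ltW p0)//.
by apply: le_trans vn; rewrite invr_ge0.
Qed.

Theorem Tmean_weak_unbounded (p : R) : 0 < p -> p < 2^-1 -> forall q : nat -> R,
  nondecreasing_seq q -> (forall k, 0 <= q k) -> 0 < q 0%N ->
  exists2 f : nat -> G -> R[i], hardy mu p f &
    ereal_sup [set weak_norm mu p (cabs (Tmean mu q n f)) |
               n in [set n | (0 < n)%N]] = +oo%E.
Proof.
move=> p0 p2 q qn q0 q00; pose d k : R := (M k)%:R `^ (2 * p)^-1.
exists (mart_sum (layer_coef m d)); first exact: hardy_layer.
set S := ereal_sup _; apply/eqP; rewrite -leye_eq leNgt; apply/negP => Sfin.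
have [K SK] : exists K : R, (S <= K%:E)%E.
  by case: S Sfin => [r _|//|_]; [exists r|exists 0; rewrite leNye].
have HK n : (0 < n)%N ->
    (weak_norm mu p (cabs (Tmean mu q n (mart_sum (layer_coef m d)))) <= K%:E)%E.
  by move=> n0; apply: le_trans SK; apply: ereal_sup_ubound; exists n.
have d0 k : 0 < d k by rewrite powR_gt0// MR_gt0.
pose w : R := 3^-1 `^ p^-1; have w0 : 0 < w by rewrite powR_gt0.
pose Z : R := `|24 * K / w|.
(* The excess of the growth of d_k over M_k, positive exactly because p < 1/2. *)
pose r : R := (2 * p)^-1 - 1.
have r0 : 0 < r.
  by rewrite subr_gt0 invf_gt1 ?mulr_gt0//; have := p2; lra.
have Z0 : 0 <= Z by exact: normr_ge0.
have Zr0 : 0 <= Z `^ r^-1 by exact: powR_ge0.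
have := archi_boundP Zr0; set k := Num.Def.archi_bound _ => Zk.
have ZM : Z < (M k)%:R `^ r.
  have -> : Z = (Z `^ r^-1) `^ r by rewrite -powRrM mulVf ?(gt_eqF r0)// powRr1.
  rewrite gt0_ltr_powR ?nnegrE//; apply: lt_trans Zk _.
  by rewrite ltr_nat ltn_Mprod.
have MR := MR_gt0 R m_ge2 k.
have := Tmean_weak_lower qn q0 q00 (d0 k) p0 HK.
rewrite -/w => h.
have dM : d k = (M k)%:R `^ r * (M k)%:R.
  rewrite -[X in _ * X](powRr1 (ltW MR)) -powRD; last by rewrite (gt_eqF MR) implybT.
  by rewrite /r subrK.
have {}h : (M k)%:R `^ r <= 24 * K / w.
  rewrite ler_pdivlMr//; move: h; rewrite dM => h.
  have -> : (M k)%:R `^ r * w = 24 * ((M k)%:R `^ r * (M k)%:R / (24 * (M k)%:R) * w).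
    by field; rewrite gt_eqF.
  by rewrite ler_wpM2l.
by have := lt_le_trans ZM (le_trans h (ler_norm _)); rewrite ltxx.
Qed.

End UnboundedMeans.

Theorem mainTheorem11 (R : realType) (m : nat -> nat)
    (m_ge2 : forall k, (2 <= m k)%N)
    (m_bounded : exists B : nat, forall k, (m k <= B)%N)
    (mu : probability (vilenkin m) R) (mu_haar : translation_invariant mu) :
  (forall q : nat -> R,
     nondecreasing_seq q -> (forall k, 0 <= q k) -> 0 < q 0%N ->
     (fun n : nat => q n.-1 / Qsum q n : R^o) =O_\oo (fun n : nat => n%:R^-1 : R^o) ->
     bounded_from_hardy mu 2^-1 (weak_norm mu 2^-1) (Tmaximal mu q)) /\
  (forall p : R, 0 < p -> p < 2^-1 ->
   forall q : nat -> R,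
     nondecreasing_seq q -> (forall k, 0 <= q k) -> 0 < q 0%N ->
     exists2 f : nat -> vilenkin m -> R[i], hardy mu p f &
       ereal_sup [set weak_norm mu p (cabs (Tmean mu q n f)) |
                  n in [set n | (0 < n)%N]] = +oo%E).
Proof.
have [B m_leB] := m_bounded; split.
  by move=> q qn q0 q00 qO; exact: (Tmaximal_weak_type m_ge2 m_leB mu_haar qn q0 q00 qO).
by move=> p p0 p2 q qn q0 q00; exact: (Tmean_weak_unbounded m_ge2 m_leB mu_haar p0 p2 qn q0 q00).
Qed.
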